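(* Assume $\mathfrak{d}=\aleph_1$. Let $X$ be a productively Lindelöf Tychonoff space that is metrizable, or just of countable type. Then $X$ is: (1) productively $\mathsf{U}_{\mathrm{fin}}(\mathrm{O},\Gamma)$; (2) productively $\mathsf{S}_{\mathrm{fin}}(\Omega,\Omega^{\mathrm{gp}})$; (3) productively $\mathsf{S}_{\mathrm{fin}}(\mathrm{O},\mathrm{O})$; (4) productively $\mathsf{S}_{\mathrm{fin}}(\Omega,\Omega)$; and (5) productively $\mathsf{U}_{\mathrm{fin}}(\mathrm{O},\Omega)$.
   Context: All spaces are Tychonoff. $\mathfrak{d}$ is the minimal cardinality of a dominating family in $(\mathbb{N}^{\mathbb{N}},\le^* )$. For a property $P$ of spaces, $X$ is productively $P$ if $X\times Y$ has property $P$ for each space $Y$ with property $P$. In particular, $X$ is productively Lindelöf if $X\times Y$ is Lindelöf for every Lindelöf $Y$. A space $X$ has countable type if each compact set in $X$ is contained in a compact set $K\subseteq X$ of countable outer character, i.e. there are countably many open sets $U_n\supseteq K$ such that every open $U\supseteq K$ contains some $U_n$. A cover of a space $X$ is a family $\mathcal{U}$ of subsets of $X$ with $X=\bigcup\mathcal{U}$ and $X\notin\mathcal{U}$. $\mathrm{O}(X)$: open covers of $X$. $\Omega(X)$: those $\mathcal{U}\in\mathrm{O}(X)$ such that each finite subset of $X$ is contained in some member of $\mathcal{U}$. $\Gamma(X)$: infinite $\mathcal{U}\in\mathrm{O}(X)$ such that each $x\in X$ is in all but finitely many members of $\mathcal{U}$. $\Omega^{\mathrm{gp}}(X)$: those open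 covers $\mathcal{U}$ for which there are an increasing $h\in\mathbb{N}^{\mathbb{N}}$ and a bijective enumeration $\mathcal{U}=\{U_n : n\in\mathbb{N}\}$ such that, for each finite $F\subseteq X$ and all but finitely many $n$, $F\subseteq U_k$ for some $k$ with $h(n)\le k<h(n+1)$. $X$ satisfies $\mathsf{S}_{\mathrm{fin}}(\mathscr{A},\mathscr{B})$ if for each sequence $\mathcal{U}_n\in\mathscr{A}(X)$, $n\in\mathbb{N}$, there are finite $\mathcal{F}_n\subseteq\mathcal{U}_n$ with $\bigcup_n\mathcal{F}_n\in\mathscr{B}(X)$. $X$ satisfies $\mathsf{U}_{\mathrm{fin}}(\mathscr{A},\mathscr{B})$ if for each sequence $\mathcal{U}_n\in\mathscr{A}(X)$, $n\in\mathbb{N}$, none containing a finite subcover, there are finite $\mathcal{F}_n\subseteq\mathcal{U}_n$ with $\{\bigcup\mathcal{F}_n : n\in\mathbb{N}\}\in\mathscr{B}(X)$. *)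

(* Defs.v *)
From mathcomp Require Import all_boot all_order all_algebra.
From mathcomp Require Import all_classical all_reals topology normedtype.

Set Implicit Arguments.
Unset Strict Implicit.
Unset Printing Implicit Defensive.

Local Open Scope classical_set_scope.
Local Open Scope card_scope.

Definition le_star (f g : nat -> nat) : Prop :=
  \forall n \near \oo, (f n <= g n)%N.

Definition dominating (D : set (nat -> nat)) : Prop :=
  forall f : nat -> nat, exists2 g, D g & le_star f g.

(* Cardinals are not objects here: [aleph1_sized A] says that the cardinality
   of [A] is the least uncountable one, and [dominating_number_is_aleph1] that
   a dominating family of least cardinality has that cardinality. *)
Definition aleph1_sized (T : Type) (A : set T) : Prop :=
  ~ countable A /\ forall (U : Type) (B : set U), ~ countable B -> A #<= B.

Definition least_dominating (D : set (nat -> nat)) : Prop :=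
  dominating D /\ forall E : set (nat -> nat), dominating E -> D #<= E.

Definition dominating_number_is_aleph1 : Prop :=
  exists2 D : set (nat -> nat), least_dominating D & aleph1_sized D.

(* By [uniform_separatorP], complete regularity of the library is separation
   of points from closed sets by continuous functions into [0, 1]. *)
Definition tychonoff_space (X : topologicalType) : Prop :=
  hausdorff_space X /\ completely_regular_space X.

Definition lindelof_space (X : topologicalType) : Prop :=
  forall U : set_system X, U `<=` open -> \bigcup_(A in U) A = [set: X] ->
  exists V : set_system X,
    [/\ V `<=` U, countable V & \bigcup_(A in V) A = [set: X]].

Definition metrizable_space (R : realType) (X : topologicalType) : Prop :=
  exists (M : metricType R) (f : X -> M) (g : M -> X),
    [/\ cancel f g, cancel g f, continuous f & continuous g].

Definition countable_outer_character (X : topologicalType) (K : set X) : Prop :=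
  exists U : nat -> set X,
    (forall n, open (U n) /\ K `<=` U n) /\
    (forall V : set X, open V -> K `<=` V -> exists n, U n `<=` V).

Definition countable_type_space (X : topologicalType) : Prop :=
  forall C : set X, compact C ->
  exists K : set X, [/\ C `<=` K, compact K & countable_outer_character K].

Definition productively (P : topologicalType -> Prop) (X : topologicalType) :
    Prop :=
  forall Y : topologicalType, tychonoff_space Y -> P Y -> P (X * Y)%type.

Definition cover_class := forall X : topologicalType, set (set_system X).

(* A cover never has the whole space as a member. *)
Definition Op : cover_class := fun X U =>
  [/\ U `<=` open, \bigcup_(A in U) A = [set: X] & ~ U [set: X]].

Definition Omega : cover_class := fun X U =>
  Op U /\
  forall F : set X, finite_set F -> exists2 A, U A & F `<=` A.

Definition Gamma : cover_class := fun X U =>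
  [/\ Op U, infinite_set U &
      forall x : X, finite_set [set A | U A /\ ~ A x]].

Definition Omega_gp : cover_class := fun X U =>
  Op U /\
  exists (h : nat -> nat) (u : nat -> set X),
    [/\ {homo h : m n / (m < n)%N},
        set_bij [set: nat] U u &
        forall F : set X, finite_set F ->
          \forall n \near \oo,
            exists2 k, (h n <= k < h n.+1)%N & F `<=` u k].

Definition S_fin (A B : cover_class) (X : topologicalType) : Prop :=
  forall U : nat -> set_system X, (forall n, A X (U n)) ->
  exists F : nat -> set_system X,
    (forall n, finite_set (F n) /\ F n `<=` U n) /\
    B X (\bigcup_n F n).

Definition has_finite_subcover (X : topologicalType) (U : set_system X) : Prop :=
  exists F : set_system X,
    [/\ F `<=` U, finite_set F & \bigcup_(A in F) A = [set: X]].

Definition U_fin (A B : cover_class) (X : topologicalType) : Prop :=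
  forall U : nat -> set_system X,
  (forall n, A X (U n)) -> (forall n, ~ has_finite_subcover (U n)) ->
  exists F : nat -> set_system X,
    (forall n, finite_set (F n) /\ F n `<=` U n) /\
    B X (range (fun n => \bigcup_(A in F n) A)).

(* Main.v *)
Require Import Defs.
From HB Require Import structures.
From mathcomp Require Import all_boot all_order all_algebra.
From mathcomp Require Import all_classical all_reals topology normedtype.
From mathcomp Require Import wochoice.

(** Let [Y] be a space with one of the five properties, and let covers of
[X * Y] be given; they may be taken countable, because [X] and its powers are
productively Lindelof. A function [f : nat -> nat] selects from the n-th cover
its first [f n + 1] members. If [C] is a compact subset of [X], then the tube
lemma turns the covers of [X * Y] into covers of [Y], and the property of [Y]
provides a function [f] whose selection works over [C]
([fibre_family_omega]). So the sets [G f] of the points of [X] over which the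
selection of [f] works absorb the compact subsets of [X], and they grow when
[f] grows modulo finite sets.

The heart of the proof ([compact_absorbing]) is that then a single [f] works
over all of [X]. Restrict [f] to a dominating family of cardinality aleph_1.
If countably many of the sets [G f] cover [X], a bound of the corresponding
functions does the job. Otherwise there is an uncountable set [A] in [X] that
meets every [G f], and so every compact set, in a countable set. Let [K] be the
Stone-Cech compactification of [X] and consider the space which consists of the
remainder [K `\` X] and of the points of [A], the latter made isolated. Because
[X] is of countable type, its remainder is Lindelof, and since [A] is countable
on compact sets, the new space is Lindelof too ([michael_lindelof]). Its product
with [X] contains a closed discrete copy of [A], so it is not Lindelof
([michael_product_not_lindelof]). This contradicts the hypothesis on [X].

The properties about omega-covers are about finite subsets of [X * Y]. For
these the argument runs in all finite powers of [X], to which the hypotheses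
on [X] pass, and one bounds the functions obtained for the various powers
([selects_prod]).

To treat the five properties at once, each is shown to be equivalent to an
instance of one scheme [selects]: from a sequence of families select finite
subfamilies such that, for every tested set (singleton or finite set), the
indices at which some selected member contains it form a large set of numbers
(infinite or cofinite). The delicate cases are [Gamma] and [Omega_gp], where a
set of selected sets has to be turned into a sequence of selections
([selects_cofinitely]) and conversely ([S_fin_Omega_gp_selects]). *)

Set Implicit Arguments.
Unset Strict Implicit.
Unset Printing Implicit Defensive.

Import Order.TTheory GRing.Theory Num.Theory.
Import numFieldNormedType.Exports.
Local Open Scope classical_set_scope.
Local Open Scope card_scope.

(** * Countable sets, compact sets and linear orders *)

Lemma countable_sub_range (T : Type) (A : set T) (x0 : T) :
  countable A -> exists h : nat -> T, A `<=` range h.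
Proof.
move=> cA; case: (pfcard_geP (B := [set: nat]) cA) => [->|[h]].
  by exists (fun=> x0).
by exists h => a Aa; have [n _ <-] := @surj _ _ _ _ h a Aa; exists n.
Qed.

Lemma countable_range (T : Type) (A : set T) :
  A !=set0 -> countable A -> exists h : nat -> T, range h = A.
Proof.
move=> [a0 Aa0] cA; case: (pfcard_geP (B := [set: nat]) cA) => [A0|[h]].
  by move: Aa0; rewrite A0.
exists h; rewrite eqEsubset; split=> [_ [n _ <-]|a Aa].
  exact: (@funS _ _ _ _ h).
by have [n _ <-] := @surj _ _ _ _ h a Aa; exists n.
Qed.

Lemma countable_setU (T : Type) (A B : set T) :
  countable A -> countable B -> countable (A `|` B).
Proof.
move=> cA cB; rewrite -bigcup2E; apply: bigcup_countable => //.
by move=> [|[|n]] _.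
Qed.

(** If [P C] fails, then the sets [A] with [P (C `\` A)] form a proper filter
without cluster point in [C]. This principle replaces every extraction of a
finite subcover below. *)
Lemma compact_ind (T : topologicalType) (C : set T) (P : set T -> Prop) :
  compact C -> P set0 -> (forall A B, A `<=` B -> P B -> P A) ->
  (forall A B, P A -> P B -> P (A `|` B)) ->
  (forall x, C x -> exists2 N, nbhs x N & P N) -> P C.
Proof.
move=> cC P0 Psub PU Ploc; apply: contrapT => nPC.
pose G : set_system T := [set A | P (C `\` A)].
have GF : Filter G.
  split; first by rewrite /G /= setDT.
    by move=> A B GA GB; rewrite /G /= setDIr; exact: PU.
  by move=> A B AB; apply: Psub => x [Cx nBx]; split=> // /AB.
have PG : ProperFilter G.
  by split=> //; rewrite /G /= setD0.
have GC : G C by rewrite /G /= setDv.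
have [x [Cx clx]] := cC _ PG GC.
have [N Nx PN] := Ploc _ Cx.
have GN : G (~` N) by apply: Psub PN => y [_ /contrapT].
by have [y []] := clx _ _ GN Nx.
Qed.

Lemma nbhs_open (T : topologicalType) (x : T) (A : set T) :
  nbhs x A -> exists V, [/\ open V, V x & V `<=` A].
Proof. by rewrite nbhsE => -[V [oV Vx] VA]; exists V. Qed.

(** Wallace's lemma, by two successive inductions on compact sets: first over [B]
for a fixed point of [A], then over [A]. *)
Lemma tube (T U : topologicalType) (A : set T) (B : set U) (W : set (T * U)) :
  compact A -> compact B -> open W -> A `*` B `<=` W ->
  exists V1 V2, [/\ open V1, open V2, A `<=` V1, B `<=` V2 & V1 `*` V2 `<=` W].
Proof.
move=> cA cB oW ABW.
have tube1 a : A a ->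
    exists V1 V2, [/\ open V1, open V2, V1 a, B `<=` V2 & V1 `*` V2 `<=` W].
  move=> Aa; pose P S := exists V1 V2,
    [/\ open V1, open V2, V1 a, S `<=` V2 & V1 `*` V2 `<=` W].
  apply: (@compact_ind _ _ P cB).
  - by exists setT, set0; split=> //; [exact: openT|exact: open0|move=> ? []].
  - move=> S S' SS' [V1 [V2 [? ? ? S'V ?]]]; exists V1, V2; split=> //.
    exact: subset_trans S'V.
  - move=> S S' [V1 [V2 [? ? ? ? V12]]] [V1' [V2' [? ? ? ? V12']]].
    exists (V1 `&` V1'), (V2 `|` V2'); split=> //.
    + exact: openI.
    + exact: openU.
    + exact: setUSS.
    + by move=> [x y] /= [[? ?] []] ?; [apply: V12|apply: V12'].
  - move=> b Bb.
    have : nbhs (a, b) W by apply: open_nbhs_nbhs; split=> //; exact: ABW.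
    move=> [[N1 N2] /= [N1a N2b] NW].
    have [V1 [oV1 V1a VN1]] := nbhs_open N1a.
    have [V2 [oV2 V2b VN2]] := nbhs_open N2b.
    exists V2; first exact: (open_nbhs_nbhs (conj oV2 V2b)).
    exists V1, V2; split=> // -[x y] /= [/VN1 ? /VN2 ?]; exact: NW.
pose P S := exists V1 V2,
  [/\ open V1, open V2, S `<=` V1, B `<=` V2 & V1 `*` V2 `<=` W].
apply: (@compact_ind _ _ P cA).
- by exists set0, setT; split=> //; [exact: open0|exact: openT|move=> ? []].
- move=> S S' SS' [V1 [V2 [? ? S'V ? ?]]]; exists V1, V2; split=> //.
  exact: subset_trans S'V.
- move=> S S' [V1 [V2 [? ? ? BV2 V12]]] [V1' [V2' [? ? ? BV2' V12']]].
  exists (V1 `|` V1'), (V2 `&` V2'); split=> //.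
  + exact: openU.
  + exact: openI.
  + exact: setUSS.
  + by move=> y By; split; [exact: BV2|exact: BV2'].
  + by move=> [x y] /= [[] ? []] ? ?; [apply: V12|apply: V12'].
- move=> a /tube1 [V1 [V2 [oV1 ? V1a ? ?]]]; exists V1.
    exact: (open_nbhs_nbhs (conj oV1 V1a)).
  by exists V1, V2; split.
Qed.

(** A linear order with countable initial segments plays the role of the ordinal
omega_1. Well-order the type. If some segment of [D] is uncountable, the
least such segment has countable initial segments, and minimality of the
cardinal of [D] injects [D] into it; pull the order back along the injection. *)
Lemma aleph1_sized_order (T : pointedType) (D : set T) : aleph1_sized D ->
  exists le : T -> T -> Prop,
    (forall f g, le f g \/ le g f) /\
    forall g, D g -> countable [set f | D f /\ le f g].
Proof.
move=> [uD minD]; have [r wo] := well_ordering_principle T.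
have r_min (A : set T) : A !=set0 ->
    exists2 z, A z & forall x, A x -> r z x.
  move=> [x Ax]; have [|z [[zA zmin] _]] := wo [pred y | `[< A y >]].
    by exists x; apply/asboolP.
  exists z; first exact/asboolP.
  by move=> y Ay; apply: zmin; apply/asboolP.
have r_tot f g : r f g \/ r g f.
  have [|z [] -> zmin] := r_min [set f; g]; first by exists f; left.
    by left; apply: zmin; right.
  by right; apply: zmin; left.
have r_anti f g : r f g -> r g f -> f = g.
  move=> rfg rgf; have [|z [_ zu]] := wo (pred2 f g).
    by exists f; rewrite inE eqxx.
  have rr h : r h h by case: (r_tot h h).
  have hz h : h \in pred2 f g -> z = h.
    move=> hfg; apply: zu; split=> // k; rewrite inE.
    by move: hfg; rewrite inE => /orP[] /eqP -> /orP[] /eqP ->.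
  by rewrite -(hz f) ?(hz g)// inE eqxx ?orbT.
pose seg g := [set f | D f /\ r f g].
have [allc|/existsNP[g1 /not_implyP[Dg1 ng1]]] :=
    pselect (forall g, D g -> countable (seg g)).
  by exists r.
have [|g0 [Dg0 bad0] min0] := r_min [set g | D g /\ ~ countable (seg g)].
  by exists g1.
pose B := seg g0 `\ g0.
have uB : ~ countable B.
  move=> cB; apply: bad0; apply: (@sub_countable _ _ _ (B `|` [set g0])).
    apply: subset_card_le => f sf; have [->|/eqP fg] := eqVneq f g0.
      by right.
    by left.
  by apply: countable_setU => //; exact: countable1.
have /pcard_leP[i] := minD _ _ uB.
exists (fun f g => r (i f) (i g)); split=> // g Dg.
have [[Dig rig] nig] : B (i g) by exact: funS.
have cig : countable (seg (i g)).
  apply: contrapT => bad; apply: nig; apply: r_anti => //.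
  exact: min0.
have /countable_injP[j jinj] := cig.
apply/countable_injP; exists (j \o i) => f h.
rewrite !inE => -[Df rf] [Dh rh] /= jfh.
have segi k : D k -> r (i k) (i g) -> i k \in seg (i g).
  by move=> Dk rk; rewrite inE; split=> //; have [[]] : B (i k) by exact: funS.
have ifh : i f = i h by apply: jinj jfh; exact: segi.
by apply: (@inj _ _ _ i) ifh; rewrite inE.
Qed.

(** * Refining a topology by isolated points *)

(** The topology of Michael's line: the points of [I] become isolated, and the
other points keep the neighbourhoods they have through [g]. Taking a map [g]
instead of a single space makes the restriction to a subset and the
refinement of the topology one construction. *)
Definition isolating (Y : choiceType) (Q : topologicalType) (g : Y -> Q)
  (I : set Y) : Type := Y.

Section Isolating.
Context (Y : choiceType) (Q : topologicalType) (g : Y -> Q) (I : set Y).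

Let iso_nbhs (y : Y) : set_system Y :=
  [set B | B y /\ (I y \/ exists2 V, nbhs (g y) V & g @^-1` V `<=` B)].

Let iso_filter y : ProperFilter (iso_nbhs y).
Proof.
split; first by move=> [].
split.
- by split=> //; right; exists setT => //; exact: filterT.
- move=> A B [Ay [Iy|[V gV VA]]] [By [Iy'|[W gW WB]]];
    split=> //; try by left.
  right; exists (V `&` W); first exact: filterI.
  by move=> z [Vz Wz]; split; [exact: VA|exact: WB].
- move=> A B AB [Ay [Iy|[V gV VA]]]; split; try exact: AB; first by left.
  by right; exists V => // z Vz; apply: AB; exact: VA.
Qed.

Let iso_singleton y (A : set Y) : iso_nbhs y A -> A y.
Proof. by case. Qed.

Let iso_iso y (A : set Y) : iso_nbhs y A -> iso_nbhs y (iso_nbhs^~ A).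
Proof.
move=> [Ay [Iy|[V gV VA]]]; split; try by [split=> //; left]; first by left.
  by split=> //; right; exists V.
right; exists V^° ; first exact: nbhs_interior.
move=> z Vz; split; first by apply: VA; exact: nbhs_singleton Vz.
by right; exists V.
Qed.

HB.instance Definition _ := Choice.on (isolating g I).
HB.instance Definition _ := hasNbhs.Build (isolating g I) iso_nbhs.
HB.instance Definition _ := Nbhs_isNbhsTopological.Build (isolating g I)
  iso_filter iso_singleton iso_iso.

Lemma isolatingE (y : isolating g I) (B : set (isolating g I)) :
  nbhs y B <-> B y /\ (I y \/ exists2 V, nbhs (g y) V & g @^-1` V `<=` B).
Proof. by []. Qed.

Lemma isolating_continuous : continuous (g : isolating g I -> Q).
Proof.
by move=> y V gV; split; [exact: nbhs_singleton gV|right; exists V].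
Qed.

Lemma isolating_open1 (y : isolating g I) : I y -> open [set y].
Proof. by move=> Iy; rewrite openE => _ ->; split=> //; left. Qed.

(** An isolated point is separated by its indicator function, which is continuous
because singletons of [Q] are closed; any other point by a function that
comes from [Q]. *)
Lemma isolating_tychonoff (R : realType) : injective g -> tychonoff_space Q ->
  tychonoff_space (isolating g I).
Proof.
move=> ginj [hQ crQ]; split.
  move=> y z cl; apply: ginj; apply: hQ => A B gA gB.
  have [x [? ?]] := cl _ _ (isolating_continuous gA) (isolating_continuous gB).
  by exists (g x).
move=> y B cB nBy; apply/(@uniform_separatorP _ R).
have : nbhs y (~` B) by apply: open_nbhs_nbhs; split=> //; exact: closed_openC.
move=> /isolatingE [_ [Iy|[V gV VB]]].
  pose f z : R := if z == y then 0%R else 1%R.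
  exists f; split.
  - move=> z; have [->|zy] := eqVneq z y.
      apply: (@cvg_near_cst _ _ (f y) f (nbhs y) _).
      by apply/isolatingE; split; [|left].
    have gzy : g z != g y by apply: contra_neq zy => /ginj.
    apply: (@cvg_near_cst _ _ (f z) f (nbhs z) _).
    apply/isolatingE; split=> //; right.
    exists (~` [set g y]); last first.
      by move=> x /= gxy; rewrite /f (negPf zy); case: eqP gxy => // ->.
    apply: open_nbhs_nbhs; split; last by move=> /= /eqP; apply/negP.
    apply: closed_openC; apply: accessible_closed_set1.
    exact: hausdorff_accessible.
  - move=> _ [z _ <-] /=; rewrite in_itv /= /f.
    by case: ifP; rewrite ?lexx ?ler01.
  - by move=> _ [_ -> <-]; rewrite /f eqxx.
  - move=> _ [z Bz <-] /=; rewrite /f; case: eqP => // zy.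
    by move: nBy; rewrite -zy.
have [V' [oV' V'gy V'V]] := nbhs_open gV.
have /(@uniform_separatorP _ R)[f [cf f01 f0 f1]] :
  uniform_separator [set g y] (~` V').
  by apply: crQ; [exact: open_closedC|move=> /(_ V'gy)].
exists (f \o g); split.
- by move=> z; apply: continuous_comp; [exact: isolating_continuous|exact: cf].
- by move=> _ [z _ <-]; apply: f01; exists (g z).
- by move=> _ [_ -> <-]; apply: f0; exists (g y).
- move=> _ [z Bz <-]; apply: f1; exists (g z) => // /V'V.
  by move=> /(VB z).
Qed.

End Isolating.

(** * The Stone-Cech embedding *)

Section Cube.
Context (R : realType) (X : topologicalType).

Definition unit_functions : set (X -> R) :=
  [set f : X -> R | continuous f /\ range f `<=` `[0%R, 1%R] ].

Definition cube : uniformType :=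
  prod_topology (fun _ : {classic unit_functions} => (R : uniformType)).

(** The closure of the range of this map is the Stone-Cech compactification of a
Tychonoff space. *)
Definition cube_embedding : X -> cube :=
  join_product (fun (f : {classic unit_functions}) => set_val f : X -> R).

Hypothesis X_tychonoff : tychonoff_space X.

Lemma cube_tychonoff : tychonoff_space cube.
Proof.
split; last exact: (@uniform_completely_regular R).
by apply: hausdorff_product => _; exact: Rhausdorff.
Qed.

Lemma unit_functions_separate :
  separate_points_from_closed
    (fun (f : {classic unit_functions}) => set_val f : X -> R).
Proof.
move=> B x cB nBx.
have [_ crX] := X_tychonoff.
have /(@uniform_separatorP _ R)[f [cf f01 f0 f1]] := crX x B cB nBx.
have uf : unit_functions f by [].
exists (SigSub (mem_set uf)); rewrite -[set_val _]/f.
have cl1 : closed [set (1 : R)%R].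
  exact: accessible_closed_set1 (hausdorff_accessible (@Rhausdorff R)) _.
move=> /(closureS f1); rewrite -(closure_id _).1 //.
have -> : f x = 0%R by apply: f0; exists x.
by move=> /eqP; rewrite eq_sym oner_eq0.
Qed.

Lemma unit_functions_continuous (f : {classic unit_functions}) :
  continuous (set_val f : X -> R).
Proof. by have [] := set_valP f. Qed.

Lemma cube_embedding_continuous : continuous cube_embedding.
Proof.
apply: join_product_continuous; first exact: unit_functions_separate.
exact: unit_functions_continuous.
Qed.

Lemma cube_embedding_inj : injective cube_embedding.
Proof.
move=> x y xy.
apply: (join_product_inj unit_functions_separate); rewrite ?in_setT //.
exact: hausdorff_accessible X_tychonoff.1.
Qed.

Lemma cube_embedding_open (U : set X) :
  open U -> exists2 V : set cube, open V & cube_embedding @^-1` V = U.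
Proof.
rewrite (join_product_initial unit_functions_separate
  unit_functions_continuous) //.
by move=> x y _ _; exact: cube_embedding_inj.
Qed.

Lemma cube_embedding_compact : compact (closure (range cube_embedding)).
Proof.
have cI : compact [set z : cube | forall f, `[0%R, 1%R] (z f)].
  apply: (@tychonoff _ (fun _ : {classic unit_functions} => R : topologicalType)
    (fun=> `[0%R, 1%R])) => _.
  exact: segment_compact.
have hQ := cube_tychonoff.1.
apply: (subclosed_compact _ cI); first exact: closed_closure.
have /closure_id -> := compact_closed hQ cI.
apply: closureS => _ [x _ <-] f.
by have [_] := set_valP f; apply; exists x.
Qed.

End Cube.

(** * A Lindelof space from the remainder *)

Section Remainder.
Context (X Q : topologicalType) (e : X -> Q).
Hypothesis Q_hausdorff : hausdorff_space Q.
Hypothesis Q_regular : regular_space Q.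
Hypothesis e_continuous : continuous e.
Hypothesis e_inj : injective e.
Hypothesis e_open : forall U : set X, open U ->
  exists2 V : set Q, open V & e @^-1` V = U.
Hypothesis e_compact : compact (closure (range e)).

Lemma embedding_preimage_compact (C : set Q) :
  compact C -> C `<=` range e -> compact (e @^-1` C).
Proof.
move=> cC Ce F PF FC.
have [z [Cz clz]] := cC (e @ F) _ FC.
have [x _ exz] := Ce _ Cz; exists x; split; first by rewrite /= exz.
move=> A B FA /nbhs_open [V [/e_open[W oW <-] Wx VB]].
have Wz : nbhs z W by apply: open_nbhs_nbhs; split=> //; rewrite -exz.
have eFA : (e @ F) (e @` A).
  exact: (filterS (@preimage_image _ _ e A) FA).
have [_ [[y Ay <-] Wy]] := clz _ _ eFA Wz.
by exists y; split=> //; exact: VB.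
Qed.

(** The easy half of the Henriksen-Isbell theorem. The sets [O n] are the largest
open sets with trace [U n] on [X]. A point outside [L] has a closed
neighbourhood disjoint from [L], and some [U n] is disjoint from it; if the
point is in the closure of [X], it cannot be in [O n]. *)
Lemma compact_remainder_gdelta (L : set X) :
  compact L -> countable_outer_character L ->
  exists O : nat -> set Q, (forall n, open (O n) /\ e @` L `<=` O n) /\
    forall z, closure (range e) z -> (forall n, O n z) -> (e @` L) z.
Proof.
move=> cL [U [oU LU]].
exists (fun n => ~` closure (e @` (~` U n))); split=> [n|z Kz Oz].
  split; first exact/closed_openC/closed_closure.
  move=> _ [x Lx <-]; have [/e_open[W oW WU] /(_ x Lx) Ux] := oU n.
  move=> clx; have [_ [[y nUy <-] Wy]] : e @` (~` U n) `&` W !=set0.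
    by apply: clx; apply: open_nbhs_nbhs; split=> //; move: Ux; rewrite -WU.
  by apply: nUy; rewrite -WU.
apply: contrapT => nLz.
have cleL : closed (e @` L).
  apply: compact_closed => //; apply: continuous_compact => //.
  exact: continuous_subspaceT.
have [N Nz NL] : exists2 N, nbhs z N & closure N `<=` ~` (e @` L).
  have : nbhs z (~` (e @` L)).
    by apply: open_nbhs_nbhs; split=> //; exact: closed_openC.
  by move=> /Q_regular [N ? ?]; exists N.
have [n Un] : exists n, U n `<=` ~` (e @^-1` closure N).
  apply: LU.
    apply: closed_openC; apply: preimage_closed => //.
    exact: closed_closure.
  by move=> x Lx /NL; apply; exists x.
apply: (Oz n) => M Mz.
have [_ [[x _ <-] [Mx Nx]]] : range e `&` (M `&` N) !=set0.
  by apply: Kz; exact: filterI.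
exists (e x); split=> //; exists x => // /Un; apply.
exact: subset_closure.
Qed.

Variable A : set X.

Definition remainder_points : set Q :=
  [set z | closure (range e) z /\ (range e z -> (e @` A) z)].

(** The Lindelof space whose product with [X] is not Lindelof, for uncountable
sets [A] that are countable on compact sets. *)
Definition michael : topologicalType :=
  isolating (set_val : remainder_points -> Q)
    [set y | (e @` A) (set_val y)].

Let val_continuous : continuous (set_val : michael -> Q).
Proof. exact: isolating_continuous. Qed.

(** Away from the points of [A], the open cover extends to an open set [W] of the
compactification [K] which contains the remainder, so [K `\` W] is a compact
part of [X]. It lies in a compact set [L] of countable outer character; [L]
is a G_delta of [K], so its complement in [K] is a countable union of compact
sets, each covered by finitely many members. The points left over are the
points of [A] in [L], and these are countably many. *)
Lemma michael_lindelof : countable_type_space X ->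
  (forall C : set X, compact C -> countable (A `&` C)) ->
  lindelof_space michael.
Proof.
move=> ctX AC U oU covU.
pose fills (S : set Q) := exists V : set_system michael,
  [/\ V `<=` U, countable V & set_val @^-1` S `<=` \bigcup_(B in V) B].
have fills_bigcup (S : nat -> set Q) :
    (forall n, fills (S n)) -> fills (\bigcup_n S n).
  move=> /choice[V fV]; exists (\bigcup_n V n); split.
  - by move=> B [n _ VB]; have [VU _ _] := fV n; exact: VU.
  - by apply: bigcup_countable => // n _; have [] := fV n.
  - move=> y [n _ Sy]; have [_ _ /(_ y Sy)[B VB By]] := fV n.
    by exists B => //; exists n.
have fills_sub S S' : S `<=` S' -> fills S' -> fills S.
  by move=> SS' [V [? ? SV]]; exists V; split=> // y /SS'; exact: SV.
have fillsU S S' : fills S -> fills S' -> fills (S `|` S').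
  move=> fS fS'.
  apply: (@fills_sub _ (\bigcup_n (if n == 0 then S else S'))).
    by move=> z [Sz|Sz]; [exists 0|exists 1].
  by apply: fills_bigcup => n; case: ifP.
have fills0 : fills set0 by exists set0; split.
have fills1 (y : michael) : fills [set set_val y].
  have [B UB By] : (\bigcup_(B in U) B) y by rewrite covU.
  exists [set B]; split=> //; first by move=> _ ->.
  by move=> z /= /val_inj ->; exists B.
pose K := closure (range e).
pose W := [set z | exists V, [/\ open V, V z & fills V]].
have oW : open W.
  rewrite openE => z [V [oV Vz fV]].
  have := open_nbhs_nbhs (conj oV Vz); apply: filterS => t Vt.
  by exists V.
have remainder_W z : K z -> ~ range e z -> W z.
  move=> Kz nez.
  have Bz : remainder_points z by [].
  pose y : michael := SigSub (mem_set Bz).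
  have [B UB By] : (\bigcup_(B in U) B) y by rewrite covU.
  have /isolatingE : nbhs y B by apply: open_nbhs_nbhs; split=> //; exact: oU.
  move=> [_ [[x _ exz]|[N Nz NB]]]; first by case: nez; exists x.
  have [V [oV Vz VN]] := nbhs_open Nz.
  exists V; split=> //; exists [set B]; split=> //; first by move=> _ ->.
  by move=> t Vt; exists B => //; apply: NB; exact: VN.
have cC : compact (K `\` W).
  rewrite setDE; apply: compact_closedI => //; exact: open_closedC.
have Ce : K `\` W `<=` range e.
  by move=> z [Kz nWz]; apply: contrapT => /(remainder_W _ Kz).
have [L [CL cL oL]] := ctX _ (embedding_preimage_compact cC Ce).
have [O [oO OL]] := compact_remainder_gdelta cL oL.
have fillsK n : fills (K `\` O n).
  have cKO : compact (K `\` O n).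
    rewrite setDE; apply: compact_closedI => //; apply: open_closedC.
    exact: (oO n).1.
  apply: (compact_ind cKO) => // z [Kz nOz].
  have [V [oV Vz fV]] : W z.
    apply: contrapT => nWz; apply: nOz; apply: (oO n).2.
    have [x _ exz] := Ce _ (conj Kz nWz).
    by exists x => //; apply: CL; rewrite /= exz.
  by exists V => //; exact: open_nbhs_nbhs (conj oV Vz).
have fillsL : fills (e @` (A `&` L)).
  have [->|/set0P AL0] := eqVneq (A `&` L) set0; first by rewrite image_set0.
  have [h hAL] := countable_range AL0 (AC _ cL).
  rewrite -hAL image_comp (_ : _ @` _ = \bigcup_n [set e (h n)]); last first.
    by rewrite eqEsubset; split=> [_ [n _ <-]|z [n _ ->]]; exists n.
  apply: fills_bigcup => n.
  have Ahn : A (h n) by have [] : (A `&` L) (h n) by rewrite -hAL; exists n.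
  have Bhn : remainder_points (e (h n)).
    by split; [apply: subset_closure; exists (h n)|exists (h n)].
  exact: (fills1 (SigSub (mem_set Bhn))).
have [V [VU cV Vcov]] : fills (\bigcup_n (K `\` O n) `|` e @` (A `&` L)).
  by apply: fillsU => //; exact: fills_bigcup.
exists V; split=> //; rewrite eqEsubset; split=> // y _; apply: Vcov => /=.
have [Ky Ay] := set_valP y.
have [[n nO]|allO] := pselect (exists n, ~ O n (set_val y)).
  by left; exists n.
right; have [x Lx exy] : (e @` L) (set_val y).
  by apply: OL => // n; apply: contrapT => nO; apply: allO; exists n.
have [|a Aa eay] := Ay; first by exists x.
have xa : x = a by apply: e_inj; rewrite exy eay.
by exists x => //; split=> //; rewrite xa.
Qed.

(** The graph of the inclusion of [A] is closed in the product because [Q] is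
Hausdorff, and it is discrete because the points of [A] are isolated in the
second factor. *)
Lemma michael_product_not_lindelof : ~ countable A ->
  ~ lindelof_space (X * michael)%type.
Proof.
move=> uA lXY.
pose Delta := [set p : X * michael | e p.1 = set_val p.2].
have oDelta : open (~` Delta).
  rewrite openE => -[x y] /= nxy.
  move: Q_hausdorff; rewrite open_hausdorff => /(_ (e x) (set_val y)) [].
    exact/eqP.
  move=> [V1 V2] /= [V1x V2y] [oV1 oV2 V12].
  move: V1x V2y; rewrite !inE => V1x V2y.
  exists (e @^-1` V1, set_val @^-1` V2).
    split; first exact: e_continuous (open_nbhs_nbhs (conj oV1 V1x)).
    exact: val_continuous (open_nbhs_nbhs (conj oV2 V2y)).
  move=> [x' y'] /= [V1x' V2y'] exy'.
  move/eqP: V12; rewrite -subset0 => /(_ (e x')); apply; split=> //.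
  by move: V2y'; rewrite /= -exy'.
pose fibre a := [set p : X * michael | set_val p.2 = e a].
pose U : set_system (X * michael)%type :=
  [set B | B = ~` Delta \/ exists2 a, A a & B = fibre a].
have oU : U `<=` open.
  move=> _ [->//|[a Aa ->]].
  have Ba : remainder_points (e a).
    by split; [apply: subset_closure; exists a|exists a].
  pose y : michael := SigSub (mem_set Ba).
  have -> : fibre a = snd @^-1` [set y].
    rewrite eqEsubset; split=> -[x z]; rewrite /fibre /=; last by move->.
    by move=> za; apply: val_inj.
  apply: open_comp; first by move=> p _; exact: cvg_snd.
  by apply: isolating_open1; exists a.
have [|V [VU cV covV]] := lXY U oU.
  rewrite eqEsubset; split=> // -[x y] _.
  have [exy|nexy] := pselect (Delta (x, y)); last first.
    by exists (~` Delta) => //; left.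
  have [Ky Ay] := set_valP y.
  have [|a Aa eay] := Ay; first by exists x.
  by exists (fibre a) => //; right; exists a.
apply: uA.
have fibreV a : A a -> V (fibre a).
  move=> Aa.
  have Ba : remainder_points (e a).
    by split; [apply: subset_closure; exists a|exists a].
  have [B VB Ba'] : (\bigcup_(B in V) B) (a, SigSub (mem_set Ba) : michael).
    by rewrite covV.
  have [BD|[b Ab BE]] := VU _ VB.
    by move: Ba'; rewrite BD => nD; case: nD.
  by move: Ba' VB; rewrite BE => /= /e_inj ->.
have /countable_injP[j jinj] := cV.
apply/countable_injP; exists (j \o fibre) => a b; rewrite !inE => Aa Ab /= jab.
have fab : fibre a = fibre b by apply: jinj jab; apply/mem_set/fibreV.
have Ba : remainder_points (e a).
  by split; [apply: subset_closure; exists a|exists a].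
have : fibre b (a, SigSub (mem_set Ba) : michael) by rewrite -fab.
exact: e_inj.
Qed.

End Remainder.

(** * Families indexed by functions and compact sets *)

(** The hypotheses on the factor [X] of the main theorem, in a form that passes
to finite powers. *)
Definition amenable (X : topologicalType) : Prop :=
  [/\ tychonoff_space X, productively lindelof_space X &
      countable_type_space X].

(** Suppose not. Order [D] with countable initial segments and pick, for each [g]
in [D], a point [x g] outside all the [M f] with [f] below [g]. The set [A]
of these points is uncountable, but meets each [M f], hence each compact set,
in a countable set. So the Michael-type space of [A] is Lindelof while its
product with [X] is not. *)
Lemma compact_absorbing_countable (R : realType) (X : topologicalType)
    (T : pointedType) (D : set T) (M : T -> set X) :
  amenable X -> aleph1_sized D ->
  (forall C : set X, compact C -> exists2 f, D f & C `<=` M f) ->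
  exists E, [/\ E `<=` D, countable E & \bigcup_(f in E) M f = [set: X]].
Proof.
move=> [tX lX ctX] DA MC; apply: contrapT => noE.
have [le [le_total seg_countable]] := aleph1_sized_order DA.
have [uD _] := DA.
have /choice[x xP] g : exists x, D g -> forall f, D f -> le f g -> ~ M f x.
  have [Dg|nDg] := pselect (D g); last first.
    have [x0|X0] := pselect (inhabited X); first by case: x0 => x0; exists x0.
    case: noE; exists set0; split=> //.
    by rewrite eqEsubset; split=> // y; case: X0; constructor.
  apply: contrapT => nox; apply: noE; exists [set f | D f /\ le f g]; split.
  - by move=> f [].
  - exact: seg_countable.
  rewrite eqEsubset; split=> // y _; apply: contrapT => ny; apply: nox.
  by exists y => _ f Df lefg My; apply: ny; exists f.
pose A := x @` D.
have countable_below f : D f -> countable (A `&` M f).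
  move=> Df; apply: (@sub_countable _ _ _ (x @` [set g | D g /\ le g f])).
    apply: subset_card_le => _ [[g Dg <-] Mx]; exists g => //; split=> //.
    by case: (le_total f g) => // lefg; case: (xP g Dg f Df lefg).
  exact: sub_countable (card_image_le _ _) (seg_countable f Df).
have uA : ~ countable A.
  move=> cA; apply: uD.
  have /choice[h hP] (a : X) : exists f, D f /\ M f a.
    have [f Df Mf] := MC _ (@compact_set1 _ a).
    by exists f; split=> //; exact: Mf.
  apply: (@sub_countable _ _ _ (\bigcup_(a in A) [set g | D g /\ le g (h a)])).
    apply: subset_card_le => g Dg; exists (x g); first by exists g.
    have [Dh Mh] := hP (x g); split=> //.
    by case: (le_total g (h (x g))) => // leh; case: (xP g Dg _ Dh leh).
  apply: bigcup_countable => // a _; apply: seg_countable.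
  by have [] := hP a.
have [hQ crQ] := cube_tychonoff R X.
have eC := cube_embedding_continuous (R := R) tX.
have eI := cube_embedding_inj (R := R) tX.
have eO := cube_embedding_open R tX.
have eK := @cube_embedding_compact R X.
apply: (michael_product_not_lindelof hQ eC eI uA).
apply: lX.
  by apply: isolating_tychonoff => //; exact: val_inj.
apply: (michael_lindelof hQ uniform_regular eC eI eO eK ctX) => C cC.
have [f Df Cf] := MC C cC.
apply: sub_countable (countable_below f Df); apply: subset_card_le.
exact: setIS.
Qed.

Lemma le_star_bound (E : set (nat -> nat)) :
  countable E -> exists f, forall g, E g -> le_star g f.
Proof.
move=> /(countable_sub_range (fun=> 0))[h Eh].
exists (fun n => \max_(i < n.+1) h i n) => g /Eh[m _ <-].
exists m => // n /= mn.
by rewrite (bigD1 (Ordinal (mn : (m < n.+1)%N))) //= leq_maxl.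
Qed.

(** The only use of the hypothesis on the dominating number: apply
[compact_absorbing_countable] to a dominating family of size aleph_1, then
bound the countably many functions obtained by a single one. *)
Lemma compact_absorbing (R : realType) (X : topologicalType)
    (G : (nat -> nat) -> set X) :
  dominating_number_is_aleph1 -> amenable X ->
  (forall f g, le_star f g -> G f `<=` G g) ->
  (forall C : set X, compact C -> exists f, C `<=` G f) ->
  exists f, G f = [set: X].
Proof.
move=> [D [domD _] DA] aX Gmono GC.
have [C cC|E [ED cE EX]] := compact_absorbing_countable R (M := G) aX DA.
  have [f Cf] := GC C cC; have [g Dg fg] := domD f.
  by exists g => //; apply: subset_trans Cf _; exact: Gmono.
have [f fE] := le_star_bound cE; exists f.
rewrite eqEsubset; split=> // x _.
have [g Eg Gx] : (\bigcup_(f in E) G f) x by rewrite EX.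
by apply: Gmono Gx; exact: fE.
Qed.

(** * Finite products and metrizable spaces *)

(** A point is separated from the complement of a box by the maximum of the
functions that separate its coordinates from the complements of the sides. *)
Lemma tychonoff_prod (R : realType) (T U : topologicalType) :
  tychonoff_space T -> tychonoff_space U -> tychonoff_space (T * U)%type.
Proof.
move=> [hT crT] [hU crU]; split.
  move=> [x y] [x' y'] cl; congr (_, _); [apply: hT|apply: hU] => A B.
    move=> Ax Bx'.
    have [||[p q] [/= ? ?]] := cl (fst @^-1` A) (fst @^-1` B).
    - by exists (A, setT) => [|[? ?] []] //; split=> //; exact: filterT.
    - by exists (B, setT) => [|[? ?] []] //; split=> //; exact: filterT.
    by exists p.
  move=> Ay By'.
  have [||[p q] [/= ? ?]] := cl (snd @^-1` A) (snd @^-1` B).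
  - by exists (setT, A) => [|[? ?] []] //; split=> //; exact: filterT.
  - by exists (setT, B) => [|[? ?] []] //; split=> //; exact: filterT.
  by exists q.
move=> [x y] B cB nB; apply/(@uniform_separatorP _ R).
have : nbhs (x, y) (~` B).
  by apply: open_nbhs_nbhs; split=> //; exact: closed_openC.
move=> [[N1 N2] /= [N1x N2y] N12].
have [V1 [oV1 V1x VN1]] := nbhs_open N1x.
have [V2 [oV2 V2y VN2]] := nbhs_open N2y.
have /(@uniform_separatorP _ R)[f [cf f01 f0 f1]] :
    uniform_separator [set x] (~` V1).
  by apply: crT; [exact: open_closedC|move=> /(_ V1x)].
have /(@uniform_separatorP _ R)[h [ch h01 h0 h1]] :
    uniform_separator [set y] (~` V2).
  by apply: crU; [exact: open_closedC|move=> /(_ V2y)].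
have cfst : continuous (f \o fst : T * U -> R).
  by move=> p; apply: continuous_comp; [exact: cvg_fst|exact: cf].
have csnd : continuous (h \o snd : T * U -> R).
  by move=> p; apply: continuous_comp; [exact: cvg_snd|exact: ch].
have f01' z : (0 <= f z <= 1)%R.
  by have := f01 (f z); rewrite /= in_itv; apply; exists z.
have h01' z : (0 <= h z <= 1)%R.
  by have := h01 (h z); rewrite /= in_itv; apply; exists z.
exists (fun p => Num.max (f p.1) (h p.2)); split.
- by move=> p; apply: continuous_max; [exact: cfst|exact: csnd].
- move=> _ [[p q] _ <-]; rewrite /= in_itv /= le_max ge_max.
  by have /andP[-> ->] := f01' p; have /andP[_ ->] := h01' q.
- move=> _ [_ -> <-] /=.
  have -> : f x = 0%R by apply: f0; exists x.
  have -> : h y = 0%R by apply: h0; exists y.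
  by rewrite maxxx.
- move=> _ [[p q] Bpq <-] /=.
  have [V1p|nV1p] := pselect (V1 p); last first.
    have -> : f p = 1%R by apply: f1; exists p.
    by apply/max_idPl; have /andP[] := h01' q.
  have -> : h q = 1%R.
    apply: h1; exists q => // V2q.
    by have := N12 (p, q) (conj (VN1 _ V1p) (VN2 _ V2q)).
  by apply/max_idPr; have /andP[] := f01' p.
Qed.

Lemma lindelof_homeo (T U : topologicalType) (f : T -> U) (g : U -> T) :
  continuous f -> continuous g -> cancel f g -> cancel g f ->
  lindelof_space T -> lindelof_space U.
Proof.
move=> cf cg fK gK lT V oV covV.
have [||W [WV cW covW]] := lT [set B | exists2 C, V C & B = f @^-1` C].
- by move=> _ [C VC ->]; apply: open_comp; [move=> x _; exact: cf|exact: oV].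
- rewrite eqEsubset; split=> // x _.
  have [C VC Cfx] : (\bigcup_(A in V) A) (f x) by rewrite covV.
  by exists (f @^-1` C) => //; exists C.
exists [set C | exists2 B, W B & C = g @^-1` B]; split.
- move=> _ [B /WV[C VC ->] ->]; rewrite -comp_preimage.
  by rewrite (_ : f \o g = id) //; apply/funext => y; rewrite /= gK.
- apply: (@sub_countable _ _ _ (preimage g @` W)).
    by apply: subset_card_le => _ [B WB ->]; exists B.
  exact: sub_countable (card_image_le _ _) cW.
- rewrite eqEsubset; split=> // y _.
  have [B WB Bgy] : (\bigcup_(A in W) A) (g y) by rewrite covW.
  by exists (g @^-1` B) => //; exists B.
Qed.

(** By associativity of the product. *)
Lemma productively_lindelof_prod (R : realType) (T U : topologicalType) :
  tychonoff_space U ->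
  productively lindelof_space T -> productively lindelof_space U ->
  productively lindelof_space (T * U)%type.
Proof.
move=> tU lT lU Y tY lY.
apply: (lindelof_homeo (@prodAr_continuous T U Y) (@prodA_continuous T U Y)).
- by move=> [? []].
- by move=> [[]].
by apply: lT; [exact: tychonoff_prod R _ _ tU tY|exact: lU].
Qed.

Lemma countable_type_prod (T U : topologicalType) :
  countable_type_space T -> countable_type_space U ->
  countable_type_space (T * U)%type.
Proof.
move=> ctT ctU C cC.
have [L1 [CL1 cL1 [V [oV LV]]]] : exists K, [/\ fst @` C `<=` K, compact K &
    countable_outer_character K].
  apply: ctT; apply: continuous_compact => //.
  by apply: continuous_subspaceT => p; exact: cvg_fst.
have [L2 [CL2 cL2 [W [oW LW]]]] : exists K, [/\ snd @` C `<=` K, compact K &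
    countable_outer_character K].
  apply: ctU; apply: continuous_compact => //.
  by apply: continuous_subspaceT => p; exact: cvg_snd.
exists (L1 `*` L2); split.
- by move=> p Cp; split; [apply: CL1; exists p|apply: CL2; exists p].
- exact: compact_setX.
pose O (ij : nat * nat) := V ij.1 `*` W ij.2.
exists (fun n => O (odflt (0, 0) (choice.unpickle n))); split=> [n|B oB LB].
  set ij := odflt _ _; have [oV1 LV1] := oV ij.1; have [oW1 LW1] := oW ij.2.
  split; last by move=> p [/= ? ?]; split; [exact: LV1|exact: LW1].
  have -> : O ij = (fst @^-1` V ij.1) `&` (snd @^-1` W ij.2) by [].
  apply: openI.
    by apply: open_comp => // p _; exact: cvg_fst.
  by apply: open_comp => // p _; exact: cvg_snd.
have [A1 [A2 [oA1 oA2 LA1 LA2 A12]]] := tube cL1 cL2 oB LB.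
have [i Vi] := LV _ oA1 LA1; have [j Wj] := LW _ oA2 LA2.
exists (choice.pickle (i, j)); rewrite choice.pickleK /=.
by move=> p [/= /Vi ? /Wj ?]; exact: A12.
Qed.

Lemma amenable_prod (R : realType) (T U : topologicalType) :
  amenable T -> amenable U -> amenable (T * U)%type.
Proof.
move=> [tT lT ctT] [tU lU ctU]; split.
- exact: tychonoff_prod R _ _ tT tU.
- exact: productively_lindelof_prod R _ _ tU lT lU.
- exact: countable_type_prod.
Qed.

(** The balls of radius [1 / (n + 1)] around a compact set form a base of its
neighbourhoods. *)
Lemma metrizable_countable_type (R : realType) (X : topologicalType) :
  metrizable_space R X -> countable_type_space X.
Proof.
move=> [M [f [g [fK gK cf cg]]]] C cC; exists C; split=> //.
pose U n := \bigcup_(c in C) f @^-1` (ball (f c) (n.+1%:R^-1 : R))%R^°.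
exists U; split=> [n|V oV CV].
  split.
    apply: bigcup_open => c _; apply: open_comp; last exact: open_interior.
    by move=> x _; exact: cf.
  move=> c Cc; exists c => //=; apply: nbhs_singleton; apply: nbhs_interior.
  by apply: nbhsx_ballx; rewrite invr_gt0 ltr0n.
pose P S := exists n : nat, forall c, S c ->
  f @^-1` (ball (f c) (n.+1%:R^-1 : R)%R) `<=` V.
suff [n nV] : P C.
  by exists n => x [c Cc /interior_subset]; exact: nV.
have ball_le (m n : nat) (y : M) : (m <= n)%N ->
    ball y (n.+1%:R^-1 : R)%R `<=` ball y (m.+1%:R^-1 : R)%R.
  by move=> mn; apply: le_ball; rewrite lef_pV2 ?posrE ?ltr0n// ler_nat.
apply: (compact_ind cC).
- by exists 0 => c [].
- by move=> A B AB [n nV]; exists n => c /AB; exact: nV.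
- move=> A B [m mV] [n nV]; exists (maxn m n) => c [Ac|Bc] x /= cx.
    by apply: (mV c Ac); apply: ball_le cx; exact: leq_maxl.
  by apply: (nV c Bc); apply: ball_le cx; exact: leq_maxr.
move=> c Cc.
have : nbhs (f c) (g @^-1` V).
  apply: cg; rewrite fK; apply: open_nbhs_nbhs; split=> //; exact: CV.
move=> /nbhs_ballP[r /= r0 rV].
have r20 : (0 < r / 2)%R by rewrite divr_gt0.
have [n] := ltr_add_invr r20; rewrite add0r => nr.
exists (f @^-1` ball (f c) (r / 2)%R); first by apply: cf; exact: nbhsx_ballx.
exists n => x /= cx y /= xy; rewrite -(fK y); apply: rV.
rewrite (splitr r); apply: ball_triangle cx _.
by apply: le_ball xy; exact: ltW.
Qed.

(** * Selection relative to a semifilter *)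

(** A notion of largeness for sets of indices, insensitive to finite changes. The
two instances [cofinitely] and [infinitely_often] account for the difference
between the Hurewicz and the Menger type properties. *)
Definition semifilter (S : set_system nat) : Prop :=
  [/\ S [set: nat], ~ S set0 &
      forall A B, S A -> (\forall n \near \oo, A n -> B n) -> S B].

Definition cofinitely : set_system nat := [set A | \forall n \near \oo, A n].

Definition infinitely_often : set_system nat :=
  [set A | forall N, exists2 n, (N <= n)%N & A n].

Lemma semifilter_cofinitely : semifilter cofinitely.
Proof.
split=> [|[N _ /(_ N (leqnn N))]|A B SA AB] //; first exact: filterT.
by apply: filterS2 SA AB => n An; apply.
Qed.

Lemma semifilter_infinitely_often : semifilter infinitely_often.
Proof.
split=> [N|/(_ 0)[]|A B SA [M _ AB] N] //; first by exists N.
have [n Nn An] := SA (maxn M N); exists n.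
  by apply: leq_trans Nn; exact: leq_maxr.
by apply: AB => //=; apply: leq_trans Nn; exact: leq_maxl.
Qed.

(** Omega-covers without the condition that the whole space be not a member, so
that the families of subsets of one factor that arise from covers of a
product are included. The flag [dir] restricts to the families that behave
like the finite unions of an open cover. *)
Definition omega_family (dir : bool) (Z : topologicalType)
    (V : set_system Z) : Prop :=
  [/\ V `<=` open,
      forall F : set Z, finite_set F -> exists2 A, V A & F `<=` A &
      dir -> forall A B, V A -> V B -> V (A `|` B)].

(** Singletons test that a selection is a cover, finite sets test that it is an
omega-cover. *)
Definition tested (b : bool) (Z : Type) (E : set Z) : Prop :=
  if b then finite_set E else exists x, E = [set x].

(** The common form of the five properties: the flag [dir] is set for the
properties of sequences of open covers and unset for those of sequences of
omega-covers, while [b] and [S] say what is selected. The whole space may be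
a member, and the condition is on the sequence of the selections, not on the
set of all selected sets; this makes the form stable under passing between a
product and a factor. *)
Definition selects (dir b : bool) (S : set_system nat) (Z : topologicalType) :
    Prop :=
  forall V : nat -> set_system Z, (forall n, omega_family dir (V n)) ->
  exists F : nat -> set_system Z,
    (forall n, finite_set (F n) /\ F n `<=` V n) /\
    forall E, tested b E -> S [set n | exists2 A, F n A & E `<=` A].

Lemma tested1 b (Z : Type) (x : Z) : tested b [set x].
Proof. by case: b => /=; [exact: finite_set1|exists x]. Qed.

Definition finite_unions (Z : Type) (U : set_system Z) : set_system Z :=
  [set A | exists F, [/\ finite_set F, F `<=` U & A = \bigcup_(B in F) B]].

Lemma finite_unions_setU (Z : Type) (U : set_system Z) A B :
  finite_unions U A -> finite_unions U B -> finite_unions U (A `|` B).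
Proof.
move=> [F [fF FU ->]] [G [fG GU ->]]; exists (F `|` G); split.
- by rewrite finite_setU.
- by move=> C [/FU|/GU].
- by rewrite bigcup_setU.
Qed.

Lemma finite_unions_cover (Z : Type) (U : set_system Z) (F : set Z) :
  \bigcup_(A in U) A = [set: Z] -> finite_set F ->
  exists2 A, finite_unions U A & F `<=` A.
Proof.
move=> covU fF.
have /choice[h hP] (z : Z) : exists A, U A /\ A z.
  have [A UA Az] : (\bigcup_(A in U) A) z by rewrite covU.
  by exists A.
exists (\bigcup_(B in h @` F) B).
  exists (h @` F); split=> //; first exact: finite_image.
  by move=> _ [z _ <-]; have [] := hP z.
by move=> z Fz; exists (h z); [exists z|have [] := hP z].
Qed.

Lemma finite_unions_omega_family dir (Z : topologicalType) (U : set_system Z) :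
  U `<=` open -> \bigcup_(A in U) A = [set: Z] ->
  omega_family dir (finite_unions U).
Proof.
move=> oU covU; split.
- by move=> _ [F [_ FU ->]]; apply: bigcup_open => B /FU /oU.
- by move=> F; exact: finite_unions_cover.
- by move=> _ A B; exact: finite_unions_setU.
Qed.

Lemma selects_countable dir b S (Z : topologicalType) (V : set_system Z) :
  semifilter S -> selects dir b S Z -> omega_family dir V ->
  exists W, [/\ W `<=` V, countable W &
    forall E, tested b E -> exists2 A, W A & E `<=` A].
Proof.
move=> [_ S0 _] sZ oV; have [F [FV FE]] := sZ (fun=> V) (fun=> oV).
exists (\bigcup_n F n); split.
- by move=> A [n _ FA]; exact: (FV n).2.
- apply: bigcup_countable => // n _; apply: finite_set_countable.
  exact: (FV n).1.
move=> E /FE SE; apply: contrapT => nE; apply: S0.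
suff -> : set0 = [set n | exists2 A, F n A & E `<=` A] by [].
rewrite eqEsubset; split=> // n [A FA EA]; case: nE.
by exists A => //; exists n.
Qed.

Lemma countable_subcover (T I : Type) (U : set_system T) (D : set I)
    (P : I -> set T) :
  countable D -> [set: T] `<=` \bigcup_(i in D) P i ->
  (forall i, D i -> exists F, [/\ finite_set F, F `<=` U &
     P i `<=` \bigcup_(B in F) B]) ->
  exists V, [/\ V `<=` U, countable V & \bigcup_(A in V) A = [set: T]].
Proof.
move=> cD covP finP.
have /choice[h hP] i : exists F, D i -> [/\ finite_set F, F `<=` U &
    P i `<=` \bigcup_(B in F) B].
  have [/finP[F FP]|nD] := pselect (D i); first by exists F.
  by exists set0.
exists (\bigcup_(i in D) h i); split.
- by move=> A [i Di hA]; have [_ hU _] := hP i Di; exact: hU.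
- apply: bigcup_countable => // i Di; apply: finite_set_countable.
  by have [] := hP i Di.
rewrite eqEsubset; split=> // x /covP[i Di Px].
have [_ _ /(_ x Px)[B hB Bx]] := hP i Di.
by exists B => //; exists i.
Qed.

Lemma selects_lindelof dir b S (Z : topologicalType) :
  semifilter S -> selects dir b S Z -> lindelof_space Z.
Proof.
move=> sS sZ U oU covU.
have oF := finite_unions_omega_family dir oU covU.
have [W [WU cW WE]] := selects_countable sS sZ oF.
apply: (countable_subcover (D := W) (P := id)) => //.
  move=> z _; have [A WA zA] := WE _ (tested1 b z).
  by exists A => //; exact: zA.
by move=> _ /WU [F [fF FU ->]]; exists F; split.
Qed.

(** * Finite powers *)

(** The power with exponent [k.+1], so that the base case is the space itself. *)
Fixpoint pow (X : topologicalType) (k : nat) : topologicalType :=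
  if k is k'.+1 then (X * pow X k')%type else X.

(** The coordinates of a point of a power. Statements about finite nonempty
subsets of [X] become statements about points of powers of [X]. *)
Fixpoint points (X : topologicalType) (k : nat) : pow X k -> set X :=
  match k return pow X k -> set X with
  | 0 => fun p => [set p]
  | k'.+1 => fun p => p.1 |` points p.2
  end.

Section Powers.
Context (X : topologicalType).

Lemma points_finite k (p : pow X k) : finite_set (points p).
Proof.
by elim: k p => [p|k IH [x p]] /=; rewrite ?finite_setU; [|split].
Qed.

Lemma points_compact k (p : pow X k) : compact (points p).
Proof.
elim: k p => [p|k IH [x p]] /=; first exact: compact_set1.
by apply: compactU; [exact: compact_set1|exact: IH].
Qed.

Lemma finite_points (F : set X) :
  finite_set F -> F !=set0 -> exists k (p : pow X k), points p = F.
Proof.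
move=> /finite_seqP[s ->]; elim: s => [[x]//|x [_ _|y s IH _]].
  by exists 0, x; rewrite eqEsubset; split=> z /=; rewrite inE => /eqP.
have [|k [p ps]] := IH; first by exists y; rewrite /= inE eqxx.
exists k.+1, (x, p); rewrite /= ps eqEsubset; split=> z /=.
  by move=> [->|zs]; rewrite inE ?eqxx// zs orbT.
by rewrite inE => /orP[/eqP->|zs]; [left|right].
Qed.

Lemma points_open k (O : set X) :
  open O -> open [set p : pow X k | points p `<=` O].
Proof.
move=> oO; elim: k => [|k IH] /=.
  rewrite (_ : [set p | _] = O) // eqEsubset.
  by split=> p /=; [apply|move=> Op _ ->].
rewrite (_ : [set p | _] =
    fst @^-1` O `&` snd @^-1` [set p : pow X k | points p `<=` O]).
  apply: openI; apply: open_comp => // p _; [exact: cvg_fst|exact: cvg_snd].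
rewrite eqEsubset; split=> -[x p] /=.
  by rewrite subUset => -[xO pO]; split=> //; exact: xO.
by move=> [xO pO]; rewrite subUset; split=> // _ ->.
Qed.

Lemma power_compact k (F : set X) :
  compact F -> compact [set p : pow X k | points p `<=` F].
Proof.
move=> cF; elim: k => [|k IH] /=.
  rewrite (_ : [set p | _] = F) // eqEsubset.
  by split=> p /=; [apply|move=> Op _ ->].
rewrite (_ : [set p | _] = F `*` [set p : pow X k | points p `<=` F]).
  exact: compact_setX.
rewrite eqEsubset; split=> -[x p] /=.
  by rewrite subUset => -[xO pO]; split=> //; exact: xO.
by move=> [xO pO]; rewrite subUset; split=> // _ ->.
Qed.

Lemma power_tube k (F : set X) (O : set (pow X k)) : compact F -> open O ->
  [set p : pow X k | points p `<=` F] `<=` O ->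
  exists V, [/\ open V, F `<=` V & [set p : pow X k | points p `<=` V] `<=` O].
Proof.
move=> cF; elim: k O => [|k IH] O oO FO /=.
  exists O; split=> //; last by move=> p; apply.
  by move=> x Fx; apply: FO => _ ->.
have [|A1 [A2 [oA1 oA2 FA1 FA2 A12]]] := tube cF (@power_compact k _ cF) oO.
  move=> [x p] [/= Fx Fp]; apply: FO => /=; rewrite subUset; split=> //.
  by move=> _ ->.
have [V [oV FV VA2]] := IH _ oA2 FA2.
exists (A1 `&` V); split; first exact: openI.
  by move=> x Fx; split; [exact: FA1|exact: FV].
move=> [x p] /=; rewrite subUset => -[xV pV]; apply: A12; split=> /=.
  by apply: (xV x _).1.
by apply: VA2 => y /pV [].
Qed.

Lemma tychonoff_pow (R : realType) k :
  tychonoff_space X -> tychonoff_space (pow X k).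
Proof. by move=> tX; elim: k => //= k IH; exact: (tychonoff_prod R). Qed.

Lemma amenable_pow (R : realType) k : amenable X -> amenable (pow X k).
Proof. by move=> aX; elim: k => //= k IH; exact: (amenable_prod R). Qed.

(** The open sets whose power is covered by finitely many members of [U] form an
omega-family: the power of a finite set is compact, and a neighbourhood of it
contains the power of an open set by [power_tube]. *)
Lemma selects_pow_lindelof S k :
  semifilter S -> selects false true S X -> lindelof_space (pow X k).
Proof.
move=> sS sX U oU covU.
pose fcov (V : set X) := exists F, [/\ finite_set F, F `<=` U &
  [set p : pow X k | points p `<=` V] `<=` \bigcup_(B in F) B].
have oF : omega_family false [set V | open V /\ fcov V].
  split=> // [V []//|F fF].
  have cF : compact F.
    have [->|/set0P/(finite_points fF)[l [p <-]]] := eqVneq F set0.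
      exact: compact0.
    exact: points_compact.
  pose P (A : set (pow X k)) := exists O : set (pow X k),
      [/\ A `<=` O, open O &
        exists G, [/\ finite_set G, G `<=` U & O `<=` \bigcup_(B in G) B]].
  have [O [FO oO [G [fG GU OG]]]] : P [set p | points p `<=` F].
    apply: (compact_ind (@power_compact k _ cF)).
    - by exists set0; split=> //; [exact: open0|exists set0; split].
    - move=> A B AB [O [BO oO GO]]; exists O; split=> //.
      exact: subset_trans BO.
    - move=> A B [O [AO oO [G [fG GU OG]]]] [O' [BO oO' [G' [fG' GU' OG']]]].
      exists (O `|` O'); split; [exact: setUSS|exact: openU|].
      exists (G `|` G'); split; first by rewrite finite_setU.
        by move=> C [/GU|/GU'].
      by rewrite bigcup_setU; exact: setUSS.
    - move=> p _.
      have [B UB Bp] : (\bigcup_(B in U) B) p by rewrite covU.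
      exists B; first exact: open_nbhs_nbhs (conj (oU _ UB) Bp).
      exists B; split=> //; first exact: oU.
      exists [set B]; split=> //; first by move=> _ ->.
      by move=> q Bq; exists B.
  have [V [oV FV VO]] := power_tube cF oO FO.
  exists V => //; split=> //; exists G; split=> //.
  exact: subset_trans OG.
have [W [WU cW WE]] := selects_countable sS sX oF.
apply: (countable_subcover (D := W)
  (P := fun V => [set p : pow X k | points p `<=` V])) => //.
  by move=> p _; have [A WA pA] := WE (points p) (points_finite p); exists A.
by move=> V /WU [].
Qed.

End Powers.

(** * Selection in products *)

Lemma finite_sub_increasing (Z : Type) (v : nat -> set Z) (F : set Z) :
  (forall m n, (m <= n)%N -> v m `<=` v n) -> \bigcup_m v m = [set: Z] ->
  finite_set F -> exists m, F `<=` v m.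
Proof.
move=> vmono covv fF.
have /choice[h hP] (z : Z) : exists m, v m z.
  have [m _ vz] : (\bigcup_m v m) z by rewrite covv.
  by exists m.
have /finite_seqP[s sE] : finite_set (h @` F) by exact: finite_image.
exists (\max_(i <- s) i) => z Fz.
apply: vmono (hP z); apply: leq_bigmax_seq => //.
have : (h @` F) (h z) by exists z.
by rewrite sE.
Qed.

Section Enumeration.
Context (R : realType) (X Y : topologicalType).
Hypotheses (X_amenable : amenable X) (Y_tychonoff : tychonoff_space Y).

Lemma grid_open k l (A : set (X * Y)) : open A ->
  open [set pq : pow X k * pow Y l | points pq.1 `*` points pq.2 `<=` A].
Proof.
move=> oA; rewrite openE => -[p q] /= pqA.
have [V1 [V2 [oV1 oV2 pV1 qV2 V12]]] :=
  tube (points_compact (p := p)) (points_compact (p := q)) oA pqA.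
exists ([set p' | points p' `<=` V1], [set q' | points q' `<=` V2]).
  by split; apply: open_nbhs_nbhs; split=> //; exact: points_open.
by move=> [p' q'] /= [p'V q'V] [x y] [/= /p'V ? /q'V ?]; exact: V12.
Qed.

Lemma sub_grid (F : set (X * Y)) : finite_set F -> F !=set0 ->
  exists k l (p : pow X k) (q : pow Y l), F `<=` points p `*` points q.
Proof.
move=> fF [z Fz].
have [k [p pE]] : exists k (p : pow X k), points p = fst @` F.
  by apply: finite_points; [exact: finite_image|exists z.1, z].
have [l [q qE]] : exists l (q : pow Y l), points q = snd @` F.
  by apply: finite_points; [exact: finite_image|exists z.2, z].
by exists k, l, p, q => t Ft; split; rewrite ?pE ?qE; exists t.
Qed.

(** A countable subcover exists because [X] is productively Lindelof; its finite
unions stay in a directed family. *)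
Lemma directed_enumeration (V : set_system (X * Y)%type) :
  lindelof_space Y -> omega_family true V ->
  exists v : nat -> set (X * Y), [/\ forall m, V (v m),
    forall F, finite_set F -> exists m, F `<=` v m &
    forall m n, (m <= n)%N -> v m `<=` v n].
Proof.
move=> lY [oV fV dirV].
have [_ lX _] := X_amenable.
have covV : \bigcup_(A in V) A = [set: X * Y].
  rewrite eqEsubset; split=> // z _.
  by have [A VA zA] := fV _ (finite_set1 z); exists A => //; exact: zA.
have [W [WV cW covW]] := lX Y Y_tychonoff lY V oV covV.
have [A0 VA0 _] := fV _ (@finite_set0 _).
have cW' : countable (A0 |` W).
  by apply: countable_setU => //; exact: countable1.
have [|h hW] := countable_range _ cW'; first by exists A0; left.
have hV n : V (h n).
  have : (A0 |` W) (h n) by rewrite -hW; exists n.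
  by move=> [->|/WV].
pose v m := \bigcup_(i in `I_m.+1) h i.
have vmono m n : (m <= n)%N -> v m `<=` v n.
  by move=> mn z [i /= im hz]; exists i => //=; exact: leq_trans mn.
exists v; split=> //.
  elim=> [|m IH].
    rewrite /v (_ : `I_1 = [set 0]) ?bigcup_set1 //.
    by rewrite eqEsubset; split=> [[]|_ ->].
  by rewrite /v IIS bigcup_setU bigcup_set1; exact: dirV.
move=> F; apply: finite_sub_increasing => //.
rewrite eqEsubset; split=> // z _.
have [A WA Az] : (\bigcup_(A in W) A) z by rewrite covW.
have [n _ hn] : range h A by rewrite hW; right.
by exists n => //; exists n => /=; rewrite ?hn.
Qed.

(** A family of open sets of [X * Y] covers the products of finite sets if and
only if its traces [grid k l A] cover the spaces [pow X k * pow Y l]; these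
are Lindelof since all powers of [X] are productively Lindelof. *)
Lemma omega_enumeration (V : set_system (X * Y)%type) :
  (forall l, lindelof_space (pow Y l)) -> omega_family false V ->
  exists v : nat -> set (X * Y), (forall m, V (v m)) /\
    forall F, finite_set F -> exists m, F `<=` v m.
Proof.
move=> lY [oV fV _].
pose grid k l A :=
  [set pq : pow X k * pow Y l | points pq.1 `*` points pq.2 `<=` A].
have /choice[W WP] (kl : nat * nat) : exists W, [/\ W `<=` V, countable W &
    [set: pow X kl.1 * pow Y kl.2] `<=` \bigcup_(A in W) grid kl.1 kl.2 A].
  have [_ lX _] := amenable_pow R kl.1 X_amenable.
  have tY := tychonoff_pow R kl.2 Y_tychonoff.
  have [||W [WV cW covW]] := lX _ tY (lY _) [set grid kl.1 kl.2 A | A in V].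
  - by move=> _ [A VA <-]; exact/grid_open/oV.
  - rewrite eqEsubset; split=> // -[p q] _.
    have [A VA pqA] := fV _ (finite_setX (points_finite p) (points_finite q)).
    by exists (grid kl.1 kl.2 A) => //; exists A.
  have /choice[g gP] B : exists A, W B -> V A /\ B = grid kl.1 kl.2 A.
    have [/WV[A VA <-]|nW] := pselect (W B); last by exists set0.
    by exists A.
  exists (g @` W); split.
  - by move=> _ [B WB <-]; have [] := gP B WB.
  - exact: sub_countable (card_image_le _ _) cW.
  move=> pq _; have [B WB Bpq] : (\bigcup_(A in W) A) pq by rewrite covW.
  by exists (g B); [exists B|have [_ <-] := gP B WB].
have [A0 VA0 _] := fV _ (@finite_set0 _).
have cW : countable (A0 |` \bigcup_kl W kl).
  apply: countable_setU; first exact: countable1.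
  by apply: bigcup_countable => // kl _; have [] := WP kl.
have [|h hW] := countable_range _ cW; first by exists A0; left.
exists h; split=> [m|F fF].
  have : (A0 |` \bigcup_kl W kl) (h m) by rewrite -hW; exists m.
  by move=> [->//|[kl _]]; have [WV _ _] := WP kl; exact: WV.
have [->|/set0P F0] := eqVneq F set0; first by exists 0.
have [k [l [p [q Fpq]]]] := sub_grid fF F0.
have [_ _ /(_ (p, q) I)[A WA pqA]] := WP (k, l).
have [m _ hm] : range h A by rewrite hW; right; exists (k, l).
by exists m; rewrite hm; exact: subset_trans pqA.
Qed.

End Enumeration.

Section Fibre.
Context (X Y : topologicalType) (v : nat -> set (X * Y)) (dir : bool).
Hypothesis v_open : forall m, open (v m).
Hypothesis v_omega : forall F, finite_set F -> exists m, F `<=` v m.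
Hypothesis v_mono : dir -> forall m n, (m <= n)%N -> v m `<=` v n.

(** The families of open subsets of [Y] to which the property of [Y] is applied:
a bound [M] for a selected [V] tells how far the sequence [v] is to be used. *)
Definition fibre_family k (C : set (pow X k)) : set_system Y :=
  [set V | open V /\ exists M, forall p, C p ->
     exists2 m, (m <= M)%N & points p `*` V `<=` v m].

(** By the tube lemma, as [C] is compact. The union of two members is a member
when the sequence [v] increases, since then the larger bound serves both. *)
Lemma fibre_family_omega k (C : set (pow X k)) :
  compact C -> omega_family dir (fibre_family C).
Proof.
move=> cC; split.
- by move=> V [].
- move=> F fF; have cF : compact F.
    have [->|/set0P/(finite_points fF)[l [p <-]]] := eqVneq F set0.
      exact: compact0.
    exact: points_compact.
  pose P (S : set (pow X k)) := exists V, [/\ open V, F `<=` V &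
    exists M, forall p, S p -> exists2 m, (m <= M)%N & points p `*` V `<=` v m].
  suff [V [oV FV [M VM]]] : P C by exists V => //; split=> //; exists M.
  apply: (compact_ind cC).
  + by exists setT; split=> //; [exact: openT|exists 0].
  + move=> A B AB [V [oV FV [M VM]]]; exists V; split=> //.
    by exists M => p /AB; exact: VM.
  + move=> A B [V [oV FV [M VM]]] [V' [oV' FV' [M' VM']]].
    exists (V `&` V'); split; first exact: openI.
      by move=> y Fy; split; [exact: FV|exact: FV'].
    exists (maxn M M') => p [/VM[m mM pV]|/VM'[m mM pV]]; exists m.
    * by apply: leq_trans mM _; exact: leq_maxl.
    * by move=> [x y] [/= px [Vy _]]; exact: pV.
    * by apply: leq_trans mM _; exact: leq_maxr.
    * by move=> [x y] [/= px [_ Vy]]; exact: pV.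
  + move=> p Cp.
    have [m pFm] := v_omega (finite_setX (points_finite p) fF).
    have [V1 [V2 [oV1 oV2 pV1 FV2 V12]]] :=
      tube (points_compact (p := p)) cF (@v_open m) pFm.
    exists [set p' | points p' `<=` V1].
      by apply: open_nbhs_nbhs; split=> //; exact: points_open.
    exists V2; split=> //; exists m => p' p'V; exists m => //.
    by move=> [x y] [/= /p'V ? ?]; exact: V12.
- move=> d A B [oA [M AM]] [oB [N BN]]; split; first exact: openU.
  exists (maxn M N) => p Cp; exists (maxn M N) => //.
  have [m mM pA] := AM p Cp; have [n nN pB] := BN p Cp.
  move=> [x y] [/= px [Ay|By]].
    apply: (v_mono d (leq_trans mM (leq_maxl M N))).
    exact: (pA (x, y)).
  apply: (v_mono d (leq_trans nN (leq_maxr M N))).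
  exact: (pB (x, y)).
Qed.

End Fibre.

Lemma finite_bound (T : Type) (F : set T) (P : T -> nat -> Prop) :
  finite_set F -> (forall x, F x -> exists M, P x M) ->
  (forall x m n, (m <= n)%N -> P x m -> P x n) ->
  exists M, forall x, F x -> P x M.
Proof.
move=> fF FP Pmono.
have /choice[h hP] x : exists M, F x -> P x M.
  by have [/FP[M PM]|nF] := pselect (F x); [exists M|exists 0].
have /finite_seqP[s sE] : finite_set (h @` F) by exact: finite_image.
exists (\max_(i <- s) i) => x Fx; apply: Pmono (hP x Fx).
apply: leq_bigmax_seq => //.
have : (h @` F) (h x) by exists x.
by rewrite sE.
Qed.

(** Enumerate countable subfamilies [v n] of the given families. For a function
[f] let [G k f] be the set of the points of [pow X k] that are well covered,
with every tested subset of [Y], by the sets [v n m] with [m <= f n]. For a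
compact set [C] of [pow X k], selection in [Y] from the families
[fibre_family (v n) C] gives [f] with [C `<=` G k f]. By [compact_absorbing]
one function [f k] serves all points of [pow X k], and a bound of the
functions [f k] modulo finite sets serves all [k]. *)
Theorem selects_prod (R : realType) (X Y : topologicalType) (dir b : bool)
    (S : set_system nat) :
  dominating_number_is_aleph1 -> amenable X -> tychonoff_space Y ->
  semifilter S -> dir || b ->
  selects dir b S Y -> selects dir b S (X * Y)%type.
Proof.
move=> d1 aX tY sS dirb sY V oV.
have [ST S0 SS] := sS.
have /choice[v vP] n : exists v : nat -> set (X * Y), [/\ forall m, V n (v m),
    forall F, finite_set F -> exists m, F `<=` v m &
    dir -> forall m m', (m <= m')%N -> v m `<=` v m'].
  case: dir {oV} (oV n) dirb sY => [on _|on /= bT] sY.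
    have [v [vV vF vmono]] :=
      directed_enumeration aX tY (selects_lindelof sS sY) on.
    by exists v; split.
  have lY l : lindelof_space (pow Y l).
    by apply: selects_pow_lindelof sS _; move: sY; rewrite bT.
  by have [v [vV vF]] := omega_enumeration R aX tY lY on; exists v.
pose good n k (f : nat -> nat) (p : pow X k) (E : set Y) :=
  exists2 m, (m <= f n)%N & points p `*` E `<=` v n m.
pose G k f := [set p : pow X k | forall E, tested b E ->
  S [set n | good n k f p E]].
have /choice[f fG] k : exists f, G k f = [set: pow X k].
  apply: (compact_absorbing R d1 (amenable_pow R k aX)).
    move=> f g fg p Gp E tE; apply: SS (Gp E tE) _.
    apply: filterS fg => n fgn [m mf pE]; exists m => //.
    exact: leq_trans fgn.
  move=> C cC.
  have [|F [FW FE]] := sY (fun n => fibre_family (v n) C).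
    move=> n; have [vV vF vm] := vP n; have [oVn _ _] := oV n.
    by apply: fibre_family_omega => // m; apply: oVn; exact: vV.
  have /choice[f fP] n : exists M, forall A, F n A -> forall p, C p ->
      exists2 m, (m <= M)%N & points p `*` A `<=` v n m.
    apply: finite_bound; first exact: (FW n).1.
      by move=> A /(FW n).2 [].
    move=> A m m' mm' AM p /AM [i im pA]; exists i => //.
    exact: leq_trans mm'.
  exists f => p Cp E tE; apply: SS (FE E tE) _; apply: nearW => n [A FA EA].
  have [m mf pA] := fP n A FA p Cp; exists m => //.
  by move=> [x y] [/= px Ey]; apply: pA; split=> //; exact: EA.
have [g gf] := le_star_bound
  (sub_countable (card_image_le f setT) (countableP _)).
exists (fun n => v n @` [set m | (m <= g n)%N]); split=> [n|E tE].
  split; last by move=> _ [m _ <-]; have [] := vP n.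
  apply: finite_image; apply: sub_finite_set (finite_II (g n).+1).
  by move=> m /=.
(* No point of a power has an empty set of coordinates. *)
have [->|/set0P E0] := eqVneq E set0.
  apply: SS ST _; apply: nearW => n _.
  by exists (v n 0) => //; exists 0.
have [k [p [F [tF EpF]]]] : exists k (p : pow X k) (F : set Y),
    tested b F /\ E `<=` points p `*` F.
  case: b tE {sY G fG dirb good} => /= [fE|[[x y] ->]].
    have [k [l [p [q Epq]]]] := sub_grid fE E0.
    by exists k, p, (points q); split=> //; exact: points_finite.
  by exists 0, x, [set y]; split=> [|_ ->]; first exists y.
have Gp : G k (f k) p by rewrite fG.
apply: SS (Gp F tF) _.
have fg : le_star (f k) g by apply: gf; exists k.
apply: filterS fg => n fgn [m mf pF]; exists (v n m).
  by exists m => //=; exact: leq_trans fgn.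
exact: subset_trans pF.
Qed.

(** * Selection principles as selection relative to a semifilter *)

Section Characterizations.
Context (Z : topologicalType).

Definition proper_family dir (V : set_system Z) : Prop :=
  omega_family dir V /\ ~ V [set: Z].

Lemma proper_family_Omega dir V : proper_family dir V -> Omega V.
Proof.
move=> [[oV fV _] pV]; split=> //; split=> //.
rewrite eqEsubset; split=> // z _.
by have [A VA zA] := fV _ (finite_set1 z); exists A => //; exact: zA.
Qed.

Lemma Omega_proper_family V : Omega V -> proper_family false V.
Proof. by move=> [[oV _ pV] fV]; split. Qed.

(** At an index where the whole space is available it is selected; such an entry
of the sequence may be replaced by any other one. *)
Lemma selects_of_proper dir b S : semifilter S ->
  (forall V : nat -> set_system Z, (forall n, proper_family dir (V n)) ->
    exists F : nat -> set_system Z,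
      (forall n, finite_set (F n) /\ F n `<=` V n) /\
      forall E, tested b E -> S [set n | exists2 A, F n A & E `<=` A]) ->
  selects dir b S Z.
Proof.
move=> [ST _ SS] sel V oV.
have [allT|/existsNP[n0 n0T]] := pselect (forall n, V n [set: Z]).
  exists (fun=> [set [set: Z]]); split.
    by move=> n; split; [exact: finite_set1|move=> _ ->].
  by move=> E _; apply: SS ST _; apply: nearW => n _; exists setT.
pose V' n := if `[< V n [set: Z] >] then V n0 else V n.
have [|F [FV FE]] := sel V'.
  by move=> n; rewrite /V'; case: ifPn => /asboolP nT; split.
exists (fun n => if `[< V n [set: Z] >] then [set [set: Z]] else F n).
split=> [n|E tE].
  have := FV n; rewrite /V'; case: ifPn => [/asboolP nT _|//].
  by split; [exact: finite_set1|move=> _ ->].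
apply: SS (FE E tE) _; apply: nearW => n [A FA EA] /=.
by case: ifPn => _; [exists setT|exists A].
Qed.

(** Apply the hypothesis to all tails of the sequence. *)
Lemma selects_infinitely_often dir b :
  (forall V : nat -> set_system Z, (forall n, proper_family dir (V n)) ->
    exists F : nat -> set_system Z,
      (forall n, finite_set (F n) /\ F n `<=` V n) /\
      forall E, tested b E -> exists n, exists2 A, F n A & E `<=` A) ->
  selects dir b infinitely_often Z.
Proof.
move=> sel; apply: selects_of_proper semifilter_infinitely_often _ => V pV.
have /choice[F FP] N := sel (fun n => V (N + n)%N) (fun n => pV _).
exists (fun n => \bigcup_(N in `I_n.+1) F N (n - N)%N); split=> [n|E tE N].
  split.
    by apply: bigcup_finite => // N _; have [FV _] := FP N; exact: (FV _).1.
  move=> A [N /= Nn FA]; have [FV _] := FP N.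
  by have := (FV _).2 _ FA; rewrite subnKC.
have [_ /(_ E tE)[n [A FA EA]]] := FP N.
exists (N + n)%N; first exact: leq_addr.
exists A => //; exists N; first by rewrite /= ltnS leq_addr.
by rewrite addKn.
Qed.

Lemma directed_finite_union V (G : set_system Z) :
  omega_family true V -> finite_set G -> G `<=` V ->
  exists2 A, V A & \bigcup_(B in G) B `<=` A.
Proof.
move=> [oV fV dirV] /finite_seqP[s ->]; elim: s => [|B s IH] GV.
  have [A VA _] := fV _ (@finite_set0 _).
  by exists A => // z [].
have [|A VA sA] := IH.
  by move=> C Cs; apply: GV; rewrite /= inE Cs orbT.
exists (B `|` A); first by apply: dirV => //; apply: GV; rewrite /= inE eqxx.
move=> z [C /=]; rewrite inE => /orP[/eqP-> Bz|Cs Cz]; first by left.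
by right; apply: sA; exists C.
Qed.

(** This is why [U_fin], which assumes that there are no finite subcovers,
applies to directed families. *)
Lemma proper_no_finite_subcover V :
  proper_family true V -> ~ has_finite_subcover V.
Proof.
move=> [oV pV] [G [GV fG covG]]; apply: pV.
have [A VA GA] := directed_finite_union oV fG GV.
suff <- : A = setT by [].
by rewrite eqEsubset; split=> //; rewrite -covG.
Qed.

(** A member selected from the finite unions of an open cover unfolds to finitely
many members of the cover. *)
Lemma selects_finite_unions b S (U : nat -> set_system Z) :
  selects true b S Z -> semifilter S -> (forall n, Op (U n)) ->
  exists F : nat -> set_system Z,
    (forall n, finite_set (F n) /\ F n `<=` U n) /\
    forall E, tested b E -> S [set n | E `<=` \bigcup_(A in F n) A].
Proof.
move=> sZ [_ _ SS] OU.
have [F [FU FE]] := sZ (fun n => finite_unions (U n)) (fun n =>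
  let: And3 oU covU _ := OU n in finite_unions_omega_family true oU covU).
have /choice[h hP] (nA : nat * set Z) : exists G, F nA.1 nA.2 ->
    [/\ finite_set G, G `<=` U nA.1 & nA.2 = \bigcup_(B in G) B].
  have [/(FU nA.1).2[G GP]|nF] := pselect (F nA.1 nA.2); first by exists G.
  by exists set0.
exists (fun n => \bigcup_(A in F n) h (n, A)); split=> [n|E tE].
  split.
    apply: bigcup_finite; first exact: (FU n).1.
    by move=> A FA; have [] := hP (n, A) FA.
  by move=> B [A FA hB]; have [_ hU _] := hP (n, A) FA; exact: hU.
apply: SS (FE E tE) _; apply: nearW => n [A FA EA] z /EA.
have [_ _ /= ->] := hP (n, A) FA => -[B hB Bz].
by exists B => //; exists A.
Qed.

Lemma S_fin_Op_selects :
  S_fin Op Op Z <-> selects true false infinitely_often Z.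
Proof.
split=> [sf|sZ].
  apply: selects_infinitely_often => V pV.
  have [n|F [FV [_ covF _]]] := sf V.
    exact: (proper_family_Omega (pV n)).1.
  exists F; split=> // _ [z ->].
  have [A [n _ FA] Az] : (\bigcup_(A in \bigcup_n F n) A) z by rewrite covF.
  by exists n, A => // _ ->.
move=> U OU.
have [F [FU FE]] := selects_finite_unions sZ semifilter_infinitely_often OU.
exists F; split=> //; split.
- by move=> A [n _ /(FU n).2]; have [oU _ _] := OU n; exact: oU.
- rewrite eqEsubset; split=> // z _.
  have [n _ /(_ z erefl)[A FA Az]] := FE _ (tested1 false z) 0.
  by exists A => //; exists n.
- by move=> [n _ /(FU n).2]; have [_ _] := OU n.
Qed.

Lemma S_fin_Omega_selects :
  S_fin Omega Omega Z <-> selects false true infinitely_often Z.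
Proof.
split=> [sf|sZ].
  apply: selects_infinitely_often => V pV.
  have [n|F [FV [_ FE]]] := sf V; first exact: (proper_family_Omega (pV n)).
  exists F; split=> // E /FE [A [n _ FA] EA].
  by exists n, A.
move=> U OU.
have [F [FU FE]] := sZ U (fun n => (Omega_proper_family (OU n)).1).
have FE' E : finite_set E -> exists2 A, (\bigcup_n F n) A & E `<=` A.
  by move=> /FE /(_ 0)[n _ [A FA EA]]; exists A => //; exists n.
exists F; split=> //; apply: (@proper_family_Omega false).
split; first split=> //.
- by move=> A [n _ /(FU n).2]; have [[oU _ _] _] := OU n; exact: oU.
- by move=> [n _ /(FU n).2]; have [[_ _]] := OU n.
Qed.

(** No union of a selected finite family is the whole space, because there are no
finite subcovers. *)
Lemma range_unions_proper (U F : nat -> set_system Z) :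
  (forall n, Op (U n)) -> (forall n, ~ has_finite_subcover (U n)) ->
  (forall n, finite_set (F n) /\ F n `<=` U n) ->
  (forall E, finite_set E -> exists n, E `<=` \bigcup_(A in F n) A) ->
  Omega (range (fun n => \bigcup_(A in F n) A)).
Proof.
move=> OU nU FU FE; apply: (@proper_family_Omega false).
split; first split=> //.
- move=> _ [n _ <-]; apply: bigcup_open => A /(FU n).2.
  by have [oU _ _] := OU n; exact: oU.
- by move=> E /FE [n En]; exists (\bigcup_(A in F n) A) => //; exists n.
- move=> [n _ Fn]; apply: (nU n); exists (F n).
  by have [] := FU n; split.
Qed.

Lemma U_fin_Omega_selects :
  U_fin Op Omega Z <-> selects true true infinitely_often Z.
Proof.
split=> [uf|sZ].
  apply: selects_infinitely_often => V pV.
  have [n|n|F [FV [_ FE]]] := uf V.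
  - exact: (proper_family_Omega (pV n)).1.
  - exact: proper_no_finite_subcover.
  have /choice[a aP] n : exists A, V n A /\ \bigcup_(B in F n) B `<=` A.
    by have [A] := directed_finite_union (pV n).1 (FV n).1 (FV n).2; exists A.
  exists (fun n => [set a n]); split=> [n|E /FE[_ [n _ <-] En]].
    by split; [exact: finite_set1|move=> _ ->; exact: (aP n).1].
  by exists n, (a n) => //; exact: subset_trans En (aP n).2.
move=> U OU nU.
have [F [FU FE]] := selects_finite_unions sZ semifilter_infinitely_often OU.
exists F; split=> //; apply: range_unions_proper OU nU FU _ => E /FE /(_ 0).
by move=> [n _ En]; exists n.
Qed.

(** Properties with target [Gamma] or [Omega_gp] speak of an enumeration [w] of
the set of selected sets, divided into blocks, and lose the index from which
each set was selected. Apply them to common refinements [V' n] of the first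
[n + 1] families. As [w] is injective and each [F n] is finite, all late
terms of [w] come from late families, so they refine [V j]; a late enough
block of [w] then gives the selection from [V j]. *)
Lemma selects_cofinitely dir b :
  (forall V : nat -> set_system Z, (forall n, proper_family dir (V n)) ->
    exists (F : nat -> set_system Z) (h : nat -> nat) (w : nat -> set Z),
    [/\ forall n, finite_set (F n) /\
          forall A, F n A -> exists2 B, V n B & A `<=` B,
        {homo h : m n / (m < n)%N},
        injective w,
        forall k, exists n, F n (w k) &
        forall E, tested b E ->
          \forall j \near \oo,
            exists2 k, (h j <= k < h j.+1)%N & E `<=` w k]) ->
  selects dir b cofinitely Z.
Proof.
move=> sel; apply: selects_of_proper semifilter_cofinitely _ => V pV.
pose V' n : set_system Z := [set W | open W /\
  forall i, (i <= n)%N -> exists2 A, V i A & W `<=` A].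
have pV' n : proper_family dir (V' n).
  split; last first.
    move=> [_ /(_ n (leqnn n))[A VA TA]]; apply: (pV n).2.
    by rewrite (_ : [set: Z] = A) // eqEsubset.
  split.
  - by move=> A [].
  - move=> E fE; elim: n => [|n [W [oW WV] EW]].
      have [[oV /(_ E fE)[A VA EA] _] _] := pV 0.
      exists A => //; split; first exact: oV.
      by move=> i; rewrite leqn0 => /eqP->; exists A.
    have [[oV /(_ E fE)[A VA EA] _] _] := pV n.+1.
    exists (W `&` A); last by move=> z Ez; split; [exact: EW|exact: EA].
    split; first by apply: openI => //; exact: oV.
    move=> i; rewrite leq_eqVlt => /orP[/eqP->|]; first by exists A => // z [].
    by rewrite ltnS => /WV [B VB WB]; exists B => // z [/WB].
  - move=> d A B [oA AV] [oB BV]; split; first exact: openU.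
    move=> i ni; have [A' VA' AA'] := AV i ni; have [B' VB' BB'] := BV i ni.
    have [[_ _ /(_ d) dirV] _] := pV i.
    by exists (A' `|` B'); [exact: dirV|exact: setUSS].
have [F [h [w [FV hmono winj wF wE]]]] := sel V' pV'.
have le_h n : (n <= h n)%N.
  by elim: n => // n IH; apply: leq_ltn_trans IH _; exact: hmono.
have /choice[c cP] j : exists i, (j <= i)%N /\
    forall k, (h i <= k)%N -> exists2 A, V j A & w k `<=` A.
  have fX : finite_set (w @^-1` \bigcup_(n in `I_j) F n).
    apply: finite_preimage; first by move=> x y _ _; exact: winj.
    by apply: bigcup_finite => // n _; exact: (FV n).1.
  have [K Kmax] : exists K, forall k,
      (\bigcup_(n in `I_j) F n) (w k) -> (k <= K)%N.
    apply: (finite_bound (P := fun k K => (k <= K)%N) fX) => [k _|k m n mn km].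
      by exists k.
    exact: leq_trans mn.
  exists (maxn j K.+1); split; first exact: leq_maxl.
  move=> k hk; have [n Fn] := wF k.
  have jn : (j <= n)%N.
    rewrite leqNgt; apply/negP => nj.
    have kK : (k <= K)%N by apply: Kmax; exists n.
    have := leq_trans (leq_trans (leq_maxr j K.+1) (le_h _)) hk.
    by rewrite ltnNge kK.
  have [B [_ /(_ j jn)[A VA BA]] wB] := (FV n).2 _ Fn.
  by exists A => //; exact: subset_trans BA.
have /choice[a aP] (jk : nat * nat) : exists A, (h (c jk.1) <= jk.2)%N ->
    V jk.1 A /\ w jk.2 `<=` A.
  have [/(cP jk.1).2[A VA wA]|nh] := pselect (h (c jk.1) <= jk.2)%N.
    by exists A.
  by exists set0.
exists (fun j =>
  (fun k => a (j, k)) @` [set k | (h (c j) <= k < h (c j).+1)%N]).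
split=> [j|E tE].
  split.
    apply: finite_image; apply: sub_finite_set (finite_II (h (c j).+1)).
    by move=> k /= /andP[].
  by move=> _ [k /= /andP[hk _] <-]; exact: (aP (j, k) hk).1.
have [N _ NE] := wE E tE; exists N => // j /= Nj.
have [k /andP[hk kh] Ek] := NE (c j) (leq_trans Nj (cP j).1).
exists (a (j, k)); first by exists k => //=; rewrite hk.
exact: subset_trans Ek (aP (j, k) hk).2.
Qed.

(** The unions of the selected families need not be distinct, but there are
infinitely many of them: otherwise a finite set meeting all their complements
would be contained in one of them. *)
Lemma U_fin_Gamma_selects :
  U_fin Op Gamma Z <-> selects true true cofinitely Z.
Proof.
split=> [uf|sZ].
  apply: selects_cofinitely => V pV.
  have [n|n|F [FV [_ iO fO]]] := uf V.
  - exact: (proper_family_Omega (pV n)).1.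
  - exact: proper_no_finite_subcover.
  have /infiniteP/pcard_leP[w] := iO.
  have winj : injective w by move=> x y; apply: inj; rewrite in_setT.
  exists (fun n => [set \bigcup_(A in F n) A]), id, w; split=> //.
  - move=> n; split; first exact: finite_set1.
    move=> _ ->.
    by have [A] := directed_finite_union (pV n).1 (FV n).1 (FV n).2; exists A.
  - move=> k; have [n _ nk] : range (fun n => \bigcup_(A in F n) A) (w k).
      exact: (@funS _ _ _ _ w).
    by exists n.
  move=> E fE.
  have fX : finite_set (w @^-1` \bigcup_(z in E)
      [set A | range (fun n => \bigcup_(A in F n) A) A /\ ~ A z]).
    apply: finite_preimage; first by move=> x y _ _; exact: winj.
    by apply: bigcup_finite.
  have [K Kmax] := finite_bound (P := fun k K => (k <= K)%N) fX
    (fun k _ => ex_intro _ k (leqnn k)) (fun k m n mn km => leq_trans km mn).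
  exists K.+1 => // j /= Kj; exists j; first by rewrite leqnn ltnSn.
  move=> z Ez; apply: contrapT => nwz.
  have : (j <= K)%N.
    by apply: Kmax; exists z => //; split=> //; exact: (@funS _ _ _ _ w).
  by rewrite leqNgt Kj.
move=> U OU nU.
have [F [FU FE]] := selects_finite_unions sZ semifilter_cofinitely OU.
exists F; split=> //.
set O := fun n => _.
have OO : Omega (range O).
  apply: range_unions_proper OU nU FU _ => E /FE [N _ NE].
  by exists N; apply: NE => /=.
have nT : forall A, range O A -> exists z, ~ A z.
  move=> A OA; apply: contrapT => nA; have [[_ _ OT] _] := OO; apply: OT.
  rewrite (_ : [set: Z] = A) // eqEsubset; split=> // z _.
  by apply: contrapT => nAz; apply: nA; exists z.
split; first exact: OO.1.
- move=> fO.
  have /choice[z zP] A : exists z, range O A -> ~ A z.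
    have [/nT[z nAz]|nOA] := pselect (range O A); first by exists z.
    have [z _] : exists z : Z, ~ O 0 z by apply: nT; exists 0.
    by exists z.
  have [N _ /(_ N (leqnn N)) NE] := FE _ (finite_image z fO).
  apply: (zP (O N)); first by exists N.
  by apply: NE; exists (O N) => //; exists N.
- move=> z; have [N _ NE] := FE _ (finite_set1 z).
  apply: (@sub_finite_set _ _ (O @` `I_N)); last exact: finite_image.
  move=> _ [[n _ <-] nz]; exists n => //=.
  by rewrite ltnNge; apply/negP => Nn; apply: nz; exact: NE Nn _ erefl.
Qed.

End Characterizations.

(** * Groupable omega-covers *)

Section Concatenation.
Context (T : eqType) (x0 : T) (l : nat -> seq T).
Hypothesis l_neq0 : forall n, l n != [::].
Hypothesis l_uniq : forall n, uniq (l n).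
Hypothesis l_disjoint : forall m n x, (m < n)%N -> x \in l m -> x \notin l n.

Let L n := flatten [seq l i | i <- iota 0 n].

Let LS n : L n.+1 = L n ++ l n.
Proof.
by rewrite /L -addn1 iotaD map_cat flatten_cat /= cats0.
Qed.

Let mem_L n x : reflect (exists2 i, (i < n)%N & x \in l i) (x \in L n).
Proof.
apply: (iffP flatten_mapP) => -[i ni xi]; exists i => //.
  by move: ni; rewrite mem_iota.
by rewrite mem_iota.
Qed.

Let L_uniq n : uniq (L n).
Proof.
elim: n => // n IH; rewrite LS cat_uniq IH l_uniq /= andbT.
apply/hasPn => x xn; apply/negP => /mem_L[i ni xi].
by have := l_disjoint ni xi; rewrite xn.
Qed.

Let h n := size (L n).

Let h_lt n : (h n < h n.+1)%N.
Proof.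
by rewrite /h LS size_cat -[ltnLHS]addn0 ltn_add2l lt0n size_eq0.
Qed.

Let h_mono : {homo h : m n / (m < n)%N}.
Proof. exact: (homo_ltn ltn_trans h_lt). Qed.

Let le_h n : (n <= h n)%N.
Proof. by elim: n => // n IH; exact: leq_ltn_trans IH (h_lt n). Qed.

Let nth_L m n k : (m <= n)%N -> (k < h m)%N -> nth x0 (L n) k = nth x0 (L m) k.
Proof.
move=> /subnK <-; elim: (n - m)%N => // d IH km.
rewrite addSn LS nth_cat -IH // ifT //.
apply: leq_trans km _; have [->//|d0] := posnP d.
by apply: ltnW; apply: h_mono; rewrite -[ltnLHS]add0n ltn_add2r.
Qed.

(** The enumeration is the concatenation of the lists, and the blocks are the
lists. *)
Lemma concatenation : exists (h : nat -> nat) (u : nat -> T),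
  [/\ {homo h : m n / (m < n)%N}, injective u,
      forall k, exists n, u k \in l n &
      forall n x, x \in l n -> exists2 k, (h n <= k < h n.+1)%N & u k = x].
Proof.
pose u k := nth x0 (L k.+1) k.
have uE n k : (k < h n)%N -> u k = nth x0 (L n) k.
  move=> kn; rewrite /u; have [nk|kn'] := leqP n k.+1; first exact: nth_L.
  by rewrite -(nth_L (ltnW kn'))//; exact: le_h.
exists h, u; split=> //.
- move=> i j uij; pose n := (maxn i j).+1.
  have ih : (i < h n)%N by apply: leq_trans (le_h n); rewrite ltnS leq_maxl.
  have jh : (j < h n)%N by apply: leq_trans (le_h n); rewrite ltnS leq_maxr.
  by move/eqP: uij; rewrite (uE n)// (uE n)// nth_uniq// => /eqP.
- move=> k; have /mem_L[i _ ki] : u k \in L k.+1 by apply/mem_nth/le_h.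
  by exists i.
- move=> n x xn; exists (h n + index x (l n))%N.
    by rewrite leq_addr /= /h LS size_cat ltn_add2l index_mem.
  have hn : (h n + index x (l n) < h n.+1)%N.
    by rewrite /h LS size_cat ltn_add2l index_mem.
  by rewrite (uE n.+1)// LS nth_cat ltnNge leq_addr /= addKn nth_index.
Qed.

End Concatenation.

(** Deleting finitely many members does not harm an omega-family that omits the
whole space: add to the finite set to be covered a point outside each of the
deleted members. *)
Lemma omega_family_remove (Z : topologicalType) (V : set_system Z)
    (s : seq (set Z)) :
  proper_family false V -> omega_family false [set A | V A /\ A \notin s].
Proof.
move=> [[oV fV _] pV]; split=> // [A []|E fE]; first by move=> /oV.
have /choice[z zP] A : exists F : set Z, finite_set F /\ (V A -> ~ F `<=` A).
  have [VA|nVA] := pselect (V A); last by exists set0.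
  have [y nAy] : exists y, ~ A y.
    apply: contrapT => nA; apply: pV.
    rewrite (_ : [set: Z] = A) // eqEsubset; split=> // y _.
    by apply: contrapT => nAy; apply: nA; exists y.
  by exists [set y]; split=> [|_ /(_ y erefl)].
have [|A VA EA] := fV (E `|` \bigcup_(B in [set` s]) z B).
  rewrite finite_setU; split=> //; apply: bigcup_finite.
    exact: finite_seq.
  by move=> B _; have [] := zP B.
exists A; last by move=> y Ey; apply: EA; left.
split=> //; apply/negP => As; apply: (zP A).2 => // y zy.
by apply: EA; right; exists A.
Qed.

(** For the converse, the groupable cover needs pairwise disjoint selections. The
sets to avoid at stage [n] depend on what was selected before, but they
belong to a countable family given in advance. So selection is applied to all
families [W n] minus a finite set [v @` t], indexed by the pairs [(n, t)];
then the selections at the pairs [(n, used n)], with [used n] the list of the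
indices of the sets selected so far, are disjoint. Since these pairs are
distinct, all but finitely many of them are good for a given finite set. *)
Lemma S_fin_Omega_gp_selects (Z : topologicalType) :
  S_fin Omega Omega_gp Z <-> selects false true cofinitely Z.
Proof.
split=> [sf|sZ].
  apply: selects_cofinitely => V pV.
  have [n|F [FV [_ [h [u [hmono [uF uinj _] uE]]]]]] := sf V.
    exact: proper_family_Omega (pV n).
  exists F, h, u; split=> //.
  - move=> n; split; first exact: (FV n).1.
    by move=> A /(FV n).2 VA; exists A.
  - by move=> x y; apply: uinj; rewrite in_setT.
  - by move=> k; have [n _ Fn] := uF k I; exists n.
move=> U OU.
have pU n := Omega_proper_family (OU n).
have /choice[W WP] n : exists W, [/\ W `<=` U n, countable W &
    forall E, finite_set E -> exists2 A, W A & E `<=` A].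
  exact: selects_countable semifilter_cofinitely sZ (pU n).1.
have pW n : proper_family false (W n).
  have [WU _ WE] := WP n; have [[oU _ _] pU'] := pU n.
  by split; [split=> // A /WU/oU|move=> /WU].
have [A0 WA0] : exists A, W 0 A.
  by have [_ _ /(_ _ (@finite_set0 _))[A WA _]] := WP 0; exists A.
have [v vW] : exists v : nat -> set Z, range v = \bigcup_n W n.
  apply: countable_range; first by exists A0, 0.
  by apply: bigcup_countable => // n _; have [] := WP n.
have /choice[idx idxP] A : exists i, (\bigcup_n W n) A -> v i = A.
  have [|nA] := pselect ((\bigcup_n W n) A); last by exists 0.
  by rewrite -vW => -[i _ <-]; exists i.
pose V e : set_system Z :=
  if choice.unpickle e is Some (n, t) then
    [set A | W n A /\ A \notin [seq v i | i <- (t : seq nat)]]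
  else W 0.
have oV e : omega_family false (V e).
  rewrite /V; case: choice.unpickle => [[n t]|]; last exact: (pW 0).1.
  exact: omega_family_remove.
have [F [FV FE]] := sZ V oV.
have /choice[a aP] e : exists A, V e A.
  have [_ /(_ _ (@finite_set0 _))[A VA _] _] := oV e.
  by exists A.
(* The extra member [a e] makes the selections, hence the blocks, nonempty. *)
have /choice[l lP] e : exists s : seq (set Z), uniq s /\ [set` s] = a e |` F e.
  have /finite_seqP[s sE] : finite_set (a e |` F e).
    by rewrite finite_setU; split; [exact: finite_set1|exact: (FV e).1].
  exists (undup s); split; first exact: undup_uniq.
  by rewrite sE; apply/seteqP; split=> x /=; rewrite mem_undup.
have lV e A : A \in l e -> V e A.
  move=> Ae; have : (a e |` F e) A by rewrite -(lP e).2.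
  by move=> [->//|]; exact: (FV e).2.
pose used := fix used n : seq nat := if n is n'.+1 then
  used n' ++ [seq idx A | A <- l (choice.pickle (n', used n'))] else [::].
pose code n := choice.pickle (n, used n).
have lW n A : A \in l (code n) ->
    W n A /\ A \notin [seq v i | i <- used n].
  by move=> /lV; rewrite /V /code choice.pickleK.
have used_mono m n A : (m < n)%N -> A \in l (code m) ->
    A \in [seq v i | i <- used n].
  move=> mn Am; have [WA _] := lW m A Am.
  have : idx A \in used n.
    elim: n mn => // n IH; rewrite ltnS leq_eqVlt => /orP[/eqP<-|/IH iA] /=.
      by rewrite mem_cat; apply/orP; right; apply/mapP; exists A.
    by rewrite mem_cat iA.
  by move=> iA; apply/mapP; exists (idx A) => //; rewrite idxP//; exists m.
have [|||h [u [hmono uinj ul lu]]] :=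
    @concatenation _ set0 (fun n => l (code n)).
- move=> n; apply/eqP => ln.
  have : a (code n) \in l (code n).
    by have := (lP (code n)).2; move/seteqP => [_]; apply; left.
  by rewrite ln.
- by move=> n; exact: (lP _).1.
- move=> m n A mn Am; apply/negP => /lW[_]; rewrite (used_mono m n)//.
exists (fun n => [set` l (code n)]); split=> [n|].
  split; first exact: finite_seq.
  by move=> A /lW[WA _]; have [WU _ _] := WP n; exact: WU.
have block E : finite_set E -> \forall n \near \oo,
    exists2 A, A \in l (code n) & E `<=` A.
  move=> /FE[N _ NE].
  have fX : finite_set (code @^-1` `I_N).
    apply: finite_preimage (finite_II N) => m n _ _.
    by move=> /(pcan_inj choice.pickleK)[].
  have [K Kmax] := finite_bound (P := fun k K => (k <= K)%N) fX
    (fun k _ => ex_intro _ k (leqnn k)) (fun k m n mn km => leq_trans km mn).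
  exists K.+1 => // n /= Kn.
  have [|A FA EA] := NE (code n).
    by rewrite /= leqNgt; apply/negP => /Kmax; rewrite leqNgt Kn.
  exists A => //.
  by have := (lP (code n)).2; move/seteqP => [_]; apply; right.
split.
  split.
  - move=> A [n _ /lW[WA _]]; have [[oW _ _] _] := pW n; exact: oW.
  - rewrite eqEsubset; split=> // z _.
    have [N _ /(_ N (leqnn N))[A Al zA]] := block _ (finite_set1 z).
    by exists A; [exists N|exact: zA].
  - by move=> [n _ /lW[WT _]]; exact: (pW n).2.
exists h, u; split=> //.
  split.
  - by move=> k _; have [n un] := ul k; exists n.
  - by move=> x y _ _; exact: uinj.
  - by move=> A [n _ /lu[k _ <-]]; exists k.
move=> E /block; apply: filterS => n [A /lu[k hk <-] EA].
by exists k.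
Qed.

(** * The five properties *)

Theorem theorem8p2 (R : realType) (X : topologicalType)
    (d_aleph1 : dominating_number_is_aleph1)
    (X_tychonoff : tychonoff_space X)
    (X_lindelof : productively lindelof_space X)
    (X_type : metrizable_space R X \/ countable_type_space X) :
  [/\ productively (U_fin Op Gamma) X,
      productively (S_fin Omega Omega_gp) X,
      productively (S_fin Op Op) X,
      productively (S_fin Omega Omega) X
    & productively (U_fin Op Omega) X].
Proof.
have aX : amenable X.
  by split=> //; case: X_type => // /metrizable_countable_type.
have transfer dir b S (P : topologicalType -> Prop) :
    (forall Z, P Z <-> selects dir b S Z) -> semifilter S -> dir || b ->
    productively P X.
  move=> PE sS dirb Y tY /PE sY; apply/PE.
  exact: (selects_prod R).
split.
- exact: transfer (@U_fin_Gamma_selects) semifilter_cofinitely _.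
- exact: transfer (@S_fin_Omega_gp_selects) semifilter_cofinitely _.
- exact: transfer (@S_fin_Op_selects) semifilter_infinitely_often _.
- exact: transfer (@S_fin_Omega_selects) semifilter_infinitely_often _.
- exact: transfer (@U_fin_Omega_selects) semifilter_infinitely_often _.
Qed.
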